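(* Let $\rho \in \mathcal{S}$ with $\rho > 0$ and $\sigma\in\mathcal{P}$ with $\sigma > 0$ such that $\rho\sigma\neq\sigma\rho$. Then for every $\alpha \in (0, \frac12)$, $D_{\alpha}^{\mathbb{P}}(\rho\|\sigma) > D_{\alpha}(\rho\|\sigma)$. In particular, there is a measurement in a fixed orthonormal basis (rank-one projective measurement) whose outcome distributions $P,Q$ satisfy $D_\alpha(P\|Q)>D_\alpha(\rho\|\sigma)$, so the sandwiched Rényi relative entropy violates the data-processing inequality for $\alpha\in(0,\frac12)$.
   Context: Work on a $d$-dimensional complex Hilbert space; $\mathcal{P}$ positive semidefinite operators, $\mathcal{S}$ density operators, $\log$ natural logarithm. The sandwiched Rényi relative entropy is $D_\alpha(\rho\|\sigma)=\frac{1}{\alpha-1}\log \operatorname{tr}\big[(\sigma^{\frac{1-\alpha}{2\alpha}}\rho\sigma^{\frac{1-\alpha}{2\alpha}})^\alpha\big]$. For $\alpha\in(0,1)$, the projectively measured Rényi relative entropy is $D^{\mathbb{P}}_\alpha(\rho\|\sigma)=\frac{1}{\alpha-1}\log \min_{\{P_i\}_{i=1}^d}\sum_i \operatorname{tr}[P_i\rho]^\alpha\operatorname{tr}[P_i\sigma]^{1-\alpha}$, minimum over families of $d$ mutually orthogonal rank-one projectors. For finite distributions, $D_\alpha(P\|Q)=\frac{1}{\alpha-1}\log\sum_x P(x)^\alpha Q(x)^{1-\alpha}$. *)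

(* Defs.v *)
(* complex numbers as pairs of Stdlib reals, d x d matrices as
   functions nat -> nat -> C (only indices < d are meaningful). *)
From Stdlib Require Import Reals Lra Arith ClassicalEpsilon.
Open Scope R_scope.

Record C := mkC { re : R; im : R }.
Definition C0 : C := mkC 0 0.
Definition C1 : C := mkC 1 0.
Definition RtoC (x : R) : C := mkC x 0.
Definition Cadd (a b : C) : C := mkC (re a + re b) (im a + im b).
Definition Cmul (a b : C) : C :=
  mkC (re a * re b - im a * im b) (re a * im b + im a * re b).
Definition Cconj (a : C) : C := mkC (re a) (- im a).

Fixpoint Csum (n : nat) (f : nat -> C) : C :=
  match n with O => C0 | S k => Cadd (Csum k f) (f k) end.
Fixpoint Rsum (n : nat) (f : nat -> R) : R :=
  match n with O => 0 | S k => Rsum k f + f k end.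

Definition Mat := nat -> nat -> C.
Definition Vec := nat -> C.

Definition mat_eq (d : nat) (A B : Mat) : Prop :=
  forall i j, (i < d)%nat -> (j < d)%nat -> A i j = B i j.
Definition mmul (d : nat) (A B : Mat) : Mat :=
  fun i j => Csum d (fun k => Cmul (A i k) (B k j)).
Definition adj (A : Mat) : Mat := fun i j => Cconj (A j i).
Definition idm : Mat := fun i j => if Nat.eqb i j then C1 else C0.
Definition diagm (l : nat -> R) : Mat :=
  fun i j => if Nat.eqb i j then RtoC (l i) else C0.
Definition mvec (d : nat) (A : Mat) (v : Vec) : Vec :=
  fun i => Csum d (fun k => Cmul (A i k) (v k)).
Definition inner (d : nat) (u v : Vec) : C :=
  Csum d (fun i => Cmul (Cconj (u i)) (v i)).
Definition trace (d : nat) (A : Mat) : C := Csum d (fun i => A i i).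

Definition hermitian (d : nat) (A : Mat) : Prop := mat_eq d A (adj A).
Definition psd (d : nat) (A : Mat) : Prop :=
  hermitian d A /\ forall v : Vec, 0 <= re (inner d v (mvec d A v)).
Definition pd (d : nat) (A : Mat) : Prop :=
  hermitian d A /\
  forall v : Vec, (exists i, (i < d)%nat /\ v i <> C0) ->
    0 < re (inner d v (mvec d A v)).
Definition density (d : nat) (A : Mat) : Prop := psd d A /\ trace d A = C1.

Definition unitary (d : nat) (U : Mat) : Prop := mat_eq d (mmul d (adj U) U) idm.

(* Functional calculus of a Hermitian matrix A = U diag(l) U^* :
   f(A) = U diag(f(l)) U^*  (well defined independently of the chosen
   decomposition; chosen by Hilbert's epsilon). *)
Definition mfun (d : nat) (f : R -> R) (A : Mat) : Mat :=
  epsilon (inhabits (fun _ _ => C0))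
    (fun B => exists (U : Mat) (l : nat -> R),
        unitary d U /\ mat_eq d A (mmul d (mmul d U (diagm l)) (adj U)) /\
        B = mmul d (mmul d U (diagm (fun i => f (l i)))) (adj U)).

Definition rpow (x y : R) : R := if Rlt_dec 0 x then Rpower x y else 0.

Definition D_sand (d : nat) (a : R) (rho sigma : Mat) : R :=
  let s := mfun d (fun x => rpow x ((1 - a) / (2 * a))) sigma in
  / (a - 1) * ln (re (trace d (mfun d (fun x => rpow x a)
                                  (mmul d (mmul d s rho) s)))).

Definition D_cl (d : nat) (a : R) (P Q : nat -> R) : R :=
  / (a - 1) * ln (Rsum d (fun x => rpow (P x) a * rpow (Q x) (1 - a))).

Definition onb (d : nat) (v : nat -> Vec) : Prop :=
  forall i j, (i < d)%nat -> (j < d)%nat ->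
    inner d (v i) (v j) = if Nat.eqb i j then C1 else C0.
Definition proj (u : Vec) : Mat := fun i j => Cmul (u i) (Cconj (u j)).
Definition meas_prob (d : nat) (rho : Mat) (v : nat -> Vec) : nat -> R :=
  fun i => re (trace d (mmul d (proj (v i)) rho)).

Definition meas_sum (d : nat) (a : R) (rho sigma : Mat) (v : nat -> Vec) : R :=
  Rsum d (fun i => rpow (meas_prob d rho v i) a * rpow (meas_prob d sigma v i) (1 - a)).

Definition meas_min (d : nat) (a : R) (rho sigma : Mat) : R :=
  epsilon (inhabits 0)
    (fun m => (exists v, onb d v /\ m = meas_sum d a rho sigma v) /\
              forall v, onb d v -> m <= meas_sum d a rho sigma v).

Definition D_meas (d : nat) (a : R) (rho sigma : Mat) : R :=
  / (a - 1) * ln (meas_min d a rho sigma).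

(* Main.v *)
(* Write gamma = (1-a)/a > 1, S = sigma^(gamma/2) and let N = S rho S have eigenvalues nu_k,
   so that the sandwiched quantity is Q = sum_k nu_k^a.  Measure in an eigenbasis w_j, with
   eigenvalues b_j, of K = S^-1 N^(1-a) S^-1.  Weighted AM-GM bounds the outcome sum by
   a sum_j <w_j, rho w_j> / b_j + (1-a) sum_j <w_j, sigma w_j> b_j^(1/gamma).
   The first sum is tr (rho K^-1) = Q.  The second is tr (A^t K^t) with A = sigma^gamma and
   t = 1/gamma < 1, and Q = tr (A^(1/2) K A^(1/2))^t; so the claim is the strict
   Araki-Lieb-Thirring inequality tr (A^t K^t) < tr (A^(1/2) K A^(1/2))^t for non-commuting
   A, K.  Since x^t is a positive mixture of the functions ln (1 + u x), u > 0, this reduces to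
   sum_ij |<e_i, f_j>|^2 ln (1 + a_i b_j) <= ln det (1 + A K) for the eigenpairs (a_i, e_i) of A
   and (b_j, f_j) of K.  That inequality follows by building up A from 0, always lowering its
   largest eigenvalue on the way back: each step changes the determinant by a rank-one factor,
   which inverse antitonicity compares with the one for a scalar A.  Strictness comes from
   small u, where the second-order term is tr (A K A K) < tr (A^2 K^2). *)
From Stdlib Require Import Reals Lra List ClassicalEpsilon.
From Coquelicot Require Import Coquelicot.
Open Scope R_scope.

(** * Signed atomic measures and the power function *)

Lemma nonneg_of_derive (f df : R -> R) (y : R) :
  0 <= y -> f 0 = 0 ->
  (forall z, 0 <= z -> is_derive f z (df z)) -> (forall z, 0 <= z -> 0 <= df z) ->
  0 <= f y.
Proof.
intros Hy H0 Hd Hp.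
destruct (MVT_gen f 0 y df) as [c [Hc E]].
- intros z Hz; rewrite Rmin_left in Hz by lra; apply Hd; lra.
- intros z Hz; rewrite Rmin_left in Hz by lra.
  apply continuity_pt_filterlim, @ex_derive_continuous.
  exists (df z); apply Hd; lra.
- rewrite Rmin_left in Hc by lra.
  assert (0 <= df c * (y - 0)) by (apply Rmult_le_pos; [apply Hp|]; lra).
  lra.
Qed.

Lemma ln1p_lower (y : R) : 0 <= y -> y - y ^ 2 / 2 <= ln (1 + y).
Proof.
intros Hy.
enough (0 <= ln (1 + y) - (y - y ^ 2 / 2)) by lra.
apply (nonneg_of_derive (fun z => ln (1 + z) - (z - z ^ 2 / 2))
         (fun z => z ^ 2 / (1 + z))); auto.
- replace (1 + 0) with 1 by ring; rewrite ln_1; field.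
- intros z Hz; auto_derive; [lra | field; lra].
- intros z Hz; apply Rdiv_le_0_compat; [apply pow2_ge_0 | lra].
Qed.

Lemma ln1p_upper (y : R) : 0 <= y -> ln (1 + y) <= y - y ^ 2 / 2 + y ^ 3 / 3.
Proof.
intros Hy.
enough (0 <= (y - y ^ 2 / 2 + y ^ 3 / 3) - ln (1 + y)) by lra.
apply (nonneg_of_derive (fun z => (z - z ^ 2 / 2 + z ^ 3 / 3) - ln (1 + z))
         (fun z => z ^ 3 / (1 + z))); auto.
- replace (1 + 0) with 1 by ring; rewrite ln_1; field.
- intros z Hz; auto_derive; [lra | field; lra].
- intros z Hz; apply Rdiv_le_0_compat; [apply pow_le; lra | lra].
Qed.

Lemma ln_le_Rpower (s y : R) : 0 < s -> 0 < y -> ln y <= Rpower y s / s.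
Proof.
intros Hs Hy.
apply Rmult_le_reg_l with s; auto.
replace (s * (Rpower y s / s)) with (Rpower y s) by (field; lra).
unfold Rpower; generalize (exp_ineq1_le (s * ln y)); lra.
Qed.

Lemma ln_le_sub1 (x : R) : 0 < x -> ln x <= x - 1.
Proof.
intros Hx; generalize (exp_ineq1_le (ln x)); rewrite exp_ln by auto; lra.
Qed.

(** With x = 1 + M b and y = 1 + (M - e) b, ln x - ln y is at most x / y - 1 = e b / y. Replacing y
    by x in the denominator costs (e b)^2 / (x y), and x, y >= 1. *)
Lemma ln_decrement (b M e : R) : 0 < b -> 0 <= e <= M ->
  ln (1 + M * b) <= ln (1 + (M - e) * b) + e * (b / (1 + M * b)) + e ^ 2 * b ^ 2.
Proof.
intros Hb He.
assert (P0 : 0 <= (M - e) * b) by (apply Rmult_le_pos; lra).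
assert (P1 : 0 <= e * b) by (apply Rmult_le_pos; lra).
set (x := 1 + M * b); set (y := 1 + (M - e) * b).
assert (Hy : 1 <= y) by (unfold y; lra).
assert (Hx : x = y + e * b) by (unfold x, y; ring).
assert (H := ln_le_sub1 (x / y) ltac:(apply Rdiv_lt_0_compat; lra)).
rewrite ln_div in H by lra.
assert (E : e * (b / x) + e ^ 2 * b ^ 2 - (x / y - 1) = (e * b) ^ 2 * ((x * y - 1) / (x * y))).
{ rewrite Hx; field; split; lra. }
assert (1 <= x * y) by (rewrite <- (Rmult_1_l 1); apply Rmult_le_compat; lra).
assert (0 <= (e * b) ^ 2 * ((x * y - 1) / (x * y))).
{ apply Rmult_le_pos; [apply pow2_ge_0 | apply Rdiv_le_0_compat; lra]. }
lra.
Qed.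

(** Follows from ln (1 + u) >= u / (1 + u). It bounds from below the logarithm of a rank-one
    determinant factor, up to a quadratic error. *)
Lemma ln_increment (u v : R) : 0 <= u <= v -> u - u ^ 2 <= ln (1 + v).
Proof.
intros H; apply Rle_trans with (ln (1 + u)); [|apply ln_le; lra].
assert (E := ln_le_sub1 (/ (1 + u)) ltac:(apply Rinv_0_lt_compat; lra)).
rewrite ln_Rinv in E by lra.
assert (F : 1 - / (1 + u) - (u - u ^ 2) = u ^ 3 / (1 + u)) by (field; lra).
assert (0 <= u ^ 3 / (1 + u)) by (apply Rdiv_le_0_compat; [apply pow_le|]; lra).
lra.
Qed.

(** For 0 < t < 1 its integral over v > 0 is finite and positive; substituting v = x u shows that
    the integral of ln (1 + x u) u^(-t-1) is x^t times this constant. *)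
Definition stieltjes_kernel (t v : R) : R := ln (1 + v) * Rpower v (- t - 1).

Lemma stieltjes_kernel_pos (t v : R) : 0 < v -> 0 < stieltjes_kernel t v.
Proof.
intros Hv; apply Rmult_lt_0_compat; [|apply exp_pos].
rewrite <- ln_1; apply ln_increasing; lra.
Qed.

Lemma stieltjes_kernel_continuous (t v : R) :
  0 < v -> continuous (stieltjes_kernel t) v.
Proof.
intros Hv; apply @ex_derive_continuous; unfold stieltjes_kernel, Rpower.
auto_derive; lra.
Qed.

Lemma stieltjes_kernel_ex_RInt (t a b : R) :
  0 < a -> 0 < b -> ex_RInt (stieltjes_kernel t) a b.
Proof.
intros Ha Hb; apply @ex_RInt_continuous; intros z Hz.
apply stieltjes_kernel_continuous.
apply Rlt_le_trans with (Rmin a b); [apply Rmin_glb_lt; auto | lra].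
Qed.

(** Based at 1, away from the singularity of the kernel at 0. Improper integrals are then limits of
    differences of this primitive. *)
Definition stieltjes_primitive (t z : R) : R := RInt (stieltjes_kernel t) 1 z.

Lemma stieltjes_primitiveB (t a b : R) : 0 < a -> 0 < b ->
  RInt (stieltjes_kernel t) a b = stieltjes_primitive t b - stieltjes_primitive t a.
Proof.
intros Ha Hb; unfold stieltjes_primitive.
rewrite <- (RInt_Chasles (stieltjes_kernel t) 1 a b);
  try (apply stieltjes_kernel_ex_RInt; lra).
symmetry; apply Rplus_minus_l.
Qed.

Lemma stieltjes_primitive_mono (t a b : R) : 0 < a -> a <= b ->
  stieltjes_primitive t a <= stieltjes_primitive t b.
Proof.
intros Ha Hb.
enough (0 <= RInt (stieltjes_kernel t) a b)
  by (rewrite stieltjes_primitiveB in H; lra).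
apply RInt_ge_0; auto.
- apply stieltjes_kernel_ex_RInt; lra.
- intros x Hx; apply Rlt_le, stieltjes_kernel_pos; lra.
Qed.

Lemma stieltjes_primitive_lt (t a b : R) : 0 < a -> a < b ->
  stieltjes_primitive t a < stieltjes_primitive t b.
Proof.
intros Ha Hb.
enough (0 < RInt (stieltjes_kernel t) a b)
  by (rewrite stieltjes_primitiveB in H; lra).
apply RInt_gt_0; auto.
- intros x Hx; apply stieltjes_kernel_pos; lra.
- intros x Hx; apply stieltjes_kernel_continuous; lra.
Qed.

Lemma Rpower_is_derive (C p v : R) : 0 < v -> p <> 0 ->
  is_derive (fun z => C / p * Rpower z p) v (C * Rpower v (p - 1)).
Proof.
intros Hv Hp; unfold Rpower; auto_derive; auto.
replace ((p - 1) * ln v) with (p * ln v + - ln v) by ring.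
rewrite exp_plus, exp_Ropp, exp_ln by auto; field; lra.
Qed.

(** Comparison with a power whose primitive is explicit. A positive [p] serves near 0 and a negative
    one near infinity. *)
Lemma stieltjes_kernel_RInt_le (t C p a b : R) : 0 < a -> a <= b -> p <> 0 ->
  (forall v, a <= v <= b -> stieltjes_kernel t v <= C * Rpower v (p - 1)) ->
  RInt (stieltjes_kernel t) a b <= C / p * Rpower b p - C / p * Rpower a p.
Proof.
intros Ha Hb Hp Hk.
assert (I : is_RInt (fun v => C * Rpower v (p - 1)) a b
              (minus (C / p * Rpower b p) (C / p * Rpower a p))).
{ apply (is_RInt_derive (fun z => C / p * Rpower z p)).
  - intros x Hx; rewrite Rmin_left in Hx by lra; apply Rpower_is_derive; lra.
  - intros x Hx; rewrite Rmin_left in Hx by lra.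
    apply @ex_derive_continuous; unfold Rpower; auto_derive; lra. }
replace (C / p * Rpower b p - C / p * Rpower a p)
  with (RInt (fun v => C * Rpower v (p - 1)) a b)
  by (rewrite (is_RInt_unique _ _ _ _ I); reflexivity).
apply RInt_le; auto.
- apply stieltjes_kernel_ex_RInt; lra.
- eexists; exact I.
- intros x Hx; apply Hk; lra.
Qed.

(** Below 1 the kernel is at most v^(-t), because ln (1 + v) <= v. Above 1 it is at most a multiple
    of v^(-t/2-1), because the logarithm grows more slowly than v^(t/2). Both powers are integrable
    on their side. *)
Lemma stieltjes_primitive_bound (t : R) : 0 < t < 1 ->
  exists K, forall z, 0 < z -> Rabs (stieltjes_primitive t z) <= K.
Proof.
intros Ht.
(* For v >= 1, ln (1 + v) <= (1 + v)^(t/2) / (t/2) <= (2 v)^(t/2) / (t/2) = C v^(t/2). *)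
set (C := Rpower 2 (t / 2) / (t / 2)).
assert (C0 : 0 < C) by (apply Rdiv_lt_0_compat; [apply exp_pos | lra]).
exists (/ (1 - t) + C / (t / 2)); intros z Hz.
assert (P0 : 0 < / (1 - t)) by (apply Rinv_0_lt_compat; lra).
assert (P1 : 0 < C / (t / 2)) by (apply Rdiv_lt_0_compat; lra).
assert (E1 : stieltjes_primitive t 1 = 0)
  by (unfold stieltjes_primitive; rewrite RInt_point; reflexivity).
assert (O : forall p, Rpower 1 p = 1)
  by (intros p; unfold Rpower; rewrite ln_1, Rmult_0_r; apply exp_0).
destruct (Rle_lt_dec z 1) as [Hz1 | Hz1].
- generalize (stieltjes_primitive_mono t z 1 Hz Hz1); rewrite E1; intros Hm.
  rewrite Rabs_left1 by auto.
  assert (RInt (stieltjes_kernel t) z 1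
     <= 1 / (1 - t) * Rpower 1 (1 - t) - 1 / (1 - t) * Rpower z (1 - t)).
  { apply stieltjes_kernel_RInt_le; try lra.
    intros v Hv; unfold stieltjes_kernel.
    replace (1 * Rpower v (1 - t - 1)) with (v * Rpower v (- t - 1)).
    + apply Rmult_le_compat_r; [apply Rlt_le, exp_pos|].
      generalize (exp_ineq1_le v); intros.
      rewrite <- (ln_exp v) at 2; apply ln_le; lra.
    + rewrite <- (Rpower_1 v) at 1 by lra; rewrite <- Rpower_plus, Rmult_1_l.
      f_equal; ring. }
  rewrite stieltjes_primitiveB, E1, O in H by lra.
  assert (0 < / (1 - t) * Rpower z (1 - t))
    by (apply Rmult_lt_0_compat; [lra | apply exp_pos]).
  lra.
- generalize (stieltjes_primitive_mono t 1 z Rlt_0_1 (Rlt_le _ _ Hz1)); rewrite E1; intros Hm.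
  rewrite Rabs_right by lra.
  assert (RInt (stieltjes_kernel t) 1 z
     <= C / (- (t / 2)) * Rpower z (- (t / 2)) - C / (- (t / 2)) * Rpower 1 (- (t / 2))).
  { apply stieltjes_kernel_RInt_le; try lra.
    intros v Hv; unfold stieltjes_kernel.
    replace (Rpower v (- (t / 2) - 1)) with (Rpower v (t / 2) * Rpower v (- t - 1))
      by (rewrite <- Rpower_plus; f_equal; field).
    rewrite <- Rmult_assoc.
    apply Rmult_le_compat_r; [apply Rlt_le, exp_pos|].
    apply Rle_trans with (Rpower (1 + v) (t / 2) / (t / 2)).
    + apply ln_le_Rpower; lra.
    + unfold C.
      replace (Rpower 2 (t / 2) / (t / 2) * Rpower v (t / 2))
        with (Rpower (2 * v) (t / 2) / (t / 2))
        by (rewrite <- Rpower_mult_distr by lra; field; lra).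
      apply Rmult_le_compat_r; [apply Rlt_le, Rinv_0_lt_compat; lra|].
      apply Rle_Rpower_l; lra. }
  rewrite stieltjes_primitiveB, E1, O in H by lra.
  replace (C / - (t / 2)) with (- (C / (t / 2))) in H by (field; lra).
  assert (0 < C / (t / 2) * Rpower z (- (t / 2)))
    by (apply Rmult_lt_0_compat; [lra | apply exp_pos]).
  lra.
Qed.

(** A bounded monotone primitive has limits at 0 and at infinity, namely its infimum and supremum,
    and [c] is their difference. The same [c] serves every scale [x], since x L and x / L still tend
    to infinity and 0. *)
Lemma stieltjes_primitive_limit (t : R) : 0 < t < 1 ->
  exists c, 0 < c /\ forall x e, 0 < x -> 0 < e -> exists L0, 0 < L0 /\
    forall L, L0 <= L ->
      Rabs (stieltjes_primitive t (x * L) - stieltjes_primitive t (x / L) - c) <= e.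
Proof.
intros Ht; destruct (stieltjes_primitive_bound t Ht) as [K HK].
destruct (completeness (fun r => exists z, 0 < z /\ r = stieltjes_primitive t z))
  as [S [HS1 HS2]].
{ exists K; intros r [z [Hz ->]]; generalize (HK z Hz), (Rle_abs (stieltjes_primitive t z)); lra. }
{ exists (stieltjes_primitive t 1), 1; split; [lra | auto]. }
destruct (completeness (fun r => exists z, 0 < z /\ r = - stieltjes_primitive t z))
  as [I [HI1 HI2]].
{ exists K; intros r [z [Hz ->]]; generalize (HK z Hz), (Rle_abs (- stieltjes_primitive t z));
    rewrite Rabs_Ropp; lra. }
{ exists (- stieltjes_primitive t 1), 1; split; [lra | auto]. }
exists (S + I); split.
{ assert (stieltjes_primitive t 2 <= S) by (apply HS1; exists 2; split; [lra | auto]).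
  assert (- stieltjes_primitive t 1 <= I) by (apply HI1; exists 1; split; [lra | auto]).
  generalize (stieltjes_primitive_lt t 1 2); lra. }
intros x e Hx He.
assert (X1 : exists z, 0 < z /\ S - e / 2 < stieltjes_primitive t z).
{ apply Classical_Prop.NNPP; intros Hn.
  assert (S <= S - e / 2); [|lra].
  apply HS2; intros r [z [Hz ->]]; apply Rnot_lt_le; intros Hl; apply Hn; eauto. }
assert (X2 : exists z, 0 < z /\ I - e / 2 < - stieltjes_primitive t z).
{ apply Classical_Prop.NNPP; intros Hn.
  assert (I <= I - e / 2); [|lra].
  apply HI2; intros r [z [Hz ->]]; apply Rnot_lt_le; intros Hl; apply Hn; eauto. }
destruct X1 as [z1 [Hz1 E1]], X2 as [z2 [Hz2 E2]].
(* Beyond this threshold x L >= z1 and x / L <= z2, where the primitive is within e / 2 of its two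
   limits. *)
exists (Rmax (z1 / x) (x / z2)).
assert (0 < z1 / x) by (apply Rdiv_lt_0_compat; auto).
split; [apply Rlt_le_trans with (z1 / x); auto; apply Rmax_l|].
intros L HL.
generalize (Rmax_l (z1 / x) (x / z2)), (Rmax_r (z1 / x) (x / z2)); intros.
assert (HL1 : z1 / x <= L) by lra; assert (HL2 : x / z2 <= L) by lra.
assert (HL0 : 0 < L) by lra.
assert (A1 : z1 <= x * L)
  by (apply Rmult_le_compat_l with (r := x) in HL1; [|lra];
      replace (x * (z1 / x)) with z1 in HL1 by (field; lra); lra).
assert (A2 : x / L <= z2).
{ apply Rmult_le_reg_r with L; auto.
  replace (x / L * L) with x by (field; lra).
  apply Rmult_le_compat_l with (r := z2) in HL2; [|lra].
  replace (z2 * (x / z2)) with x in HL2 by (field; lra); lra. }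
assert (P2 : 0 < x / L) by (apply Rdiv_lt_0_compat; auto).
assert (P1 : 0 < x * L) by (apply Rmult_lt_0_compat; auto).
generalize (stieltjes_primitive_mono t _ _ Hz1 A1),
  (stieltjes_primitive_mono t _ _ P2 A2); intros.
assert (stieltjes_primitive t (x * L) <= S) by (apply HS1; eauto).
assert (- stieltjes_primitive t (x / L) <= I) by (apply HI1; eauto).
apply Rabs_le; lra.
Qed.

(* [wsum l f] is the integral of [f] against the signed atomic measure with mass [c] at [x] for each [(c, x)] in [l]. *)
Definition wsum (l : list (R * R)) (f : R -> R) : R :=
  fold_right (fun p s => fst p * f (snd p) + s) 0 l.

Definition wsum_abs (l : list (R * R)) (f : R -> R) : R :=
  fold_right (fun p s => Rabs (fst p) * f (snd p) + s) 0 l.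

Lemma wsum_perturb (l : list (R * R)) (f g h : R -> R) :
  (forall p, In p l -> Rabs (f (snd p) - g (snd p)) <= h (snd p)) ->
  wsum l g - wsum_abs l h <= wsum l f <= wsum l g + wsum_abs l h.
Proof.
induction l as [|[c x] l IH]; simpl; intros H; [lra|].
assert (IH' := IH (fun p Hp => H p (or_intror Hp))).
assert (Hx := H (c, x) (or_introl eq_refl)); simpl in Hx.
assert (Rabs (c * f x - c * g x) <= Rabs c * h x).
{ replace (c * f x - c * g x) with (c * (f x - g x)) by ring.
  rewrite Rabs_mult; apply Rmult_le_compat_l; [apply Rabs_pos | auto]. }
apply Rabs_le_between in H0; lra.
Qed.

Lemma wsum_scal (l : list (R * R)) (k : R) (f : R -> R) :
  wsum l (fun x => k * f x) = k * wsum l f.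
Proof. induction l as [|[c x] l IH]; simpl; [ring | rewrite IH; ring]. Qed.

Lemma wsum_abs_scal (l : list (R * R)) (k : R) (f : R -> R) :
  wsum_abs l (fun x => k * f x) = k * wsum_abs l f.
Proof. induction l as [|[c x] l IH]; simpl; [ring | rewrite IH; ring]. Qed.

Lemma wsum_minus (l : list (R * R)) (f g : R -> R) :
  wsum l (fun x => f x - g x) = wsum l f - wsum l g.
Proof. induction l as [|[c x] l IH]; simpl; [ring | rewrite IH; ring]. Qed.

Lemma wsum_abs_nonneg (l : list (R * R)) (f : R -> R) :
  (forall p, In p l -> 0 <= f (snd p)) -> 0 <= wsum_abs l f.
Proof.
induction l as [|[c x] l IH]; simpl; intros H; [lra|].
assert (0 <= Rabs c * f x)
  by (apply Rmult_le_pos; [apply Rabs_pos | apply (H (c, x)); auto]).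
assert (0 <= wsum_abs l f) by (apply IH; auto); lra.
Qed.

Lemma wsum_is_RInt (l : list (R * R)) (f : R -> R -> R) (F : R -> R) (a b : R) :
  (forall p, In p l -> is_RInt (f (snd p)) a b (F (snd p))) ->
  is_RInt (fun u => wsum l (fun x => f x u)) a b (wsum l F).
Proof.
induction l as [|[c x] l IH]; simpl; intros H.
- assert (H0 := @is_RInt_const R_NormedModule a b 0).
  unfold scal in H0; simpl in H0; unfold mult in H0; simpl in H0.
  rewrite Rmult_0_r in H0; exact H0.
- apply @is_RInt_plus; [|apply IH; auto].
  apply @is_RInt_scal, (H (c, x)); auto.
Qed.

(** Substitution v = x u: the Jacobian x and the factor x^(-t-1) of the kernel are balanced by
    x^t. *)
Lemma stieltjes_kernel_scaled (t x a b : R) : 0 < x -> 0 < a -> 0 < b ->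
  is_RInt (fun u => ln (1 + x * u) * Rpower u (- t - 1)) a b
    (Rpower x t * (stieltjes_primitive t (x * b) - stieltjes_primitive t (x * a))).
Proof.
intros Hx Ha Hb.
assert (A : 0 < x * a) by (apply Rmult_lt_0_compat; auto).
assert (B : 0 < x * b) by (apply Rmult_lt_0_compat; auto).
rewrite <- stieltjes_primitiveB by auto.
assert (I : is_RInt (stieltjes_kernel t) (x * a + 0) (x * b + 0)
              (RInt (stieltjes_kernel t) (x * a) (x * b))).
{ rewrite !Rplus_0_r; apply @RInt_correct, stieltjes_kernel_ex_RInt; auto. }
apply is_RInt_comp_lin in I.
apply (is_RInt_scal _ _ _ (Rpower x t)) in I.
eapply is_RInt_ext; [|exact I].
intros u Hu.
assert (0 < u) by (generalize (Rmin_glb_lt _ _ _ Ha Hb); lra).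
unfold scal; simpl; unfold mult; simpl; unfold stieltjes_kernel.
rewrite Rplus_0_r, <- Rpower_mult_distr by auto.
replace (Rpower x t * (x * (ln (1 + x * u) * (Rpower x (- t - 1) * Rpower u (- t - 1)))))
  with ((Rpower x t * x * Rpower x (- t - 1)) * (ln (1 + x * u) * Rpower u (- t - 1)))
  by ring.
replace (Rpower x t * x * Rpower x (- t - 1)) with 1; [ring|].
rewrite <- (Rpower_1 x) at 2 by auto.
rewrite <- !Rpower_plus.
replace (t + 1 + (- t - 1)) with 0 by ring.
symmetry; apply Rpower_O; auto.
Qed.

(* [x ^ t] is proportional to the integral of [ln (1 + x u) u ^ (-t-1)] over [u > 0]; strictness comes from small [u], where the second moment dominates. *)
Lemma wsum_Rpower_pos (l : list (R * R)) (t : R) : 0 < t < 1 ->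
  (forall p, In p l -> 0 < snd p) ->
  (forall u, 0 < u -> 0 <= wsum l (fun x => ln (1 + x * u))) ->
  wsum l (fun x => x) = 0 -> wsum l (fun x => x ^ 2) < 0 ->
  0 < wsum l (fun x => Rpower x t).
Proof.
intros Ht Hx Hln H1 H2.
set (K := wsum_abs l (fun x => x ^ 3 / 3)).
assert (HK : 0 <= K).
{ apply wsum_abs_nonneg; intros p Hp; generalize (pow_lt _ 3 (Hx p Hp)); lra. }
set (m := - wsum l (fun x => x ^ 2)).
assert (Hm : 0 < m) by (unfold m; lra).
(* For u <= u0 the cubic Taylor error u^3 K is at most u^2 m / 3, less than the second-order gain
   u^2 m / 2. *)
set (u0 := m / (3 * (K + 1))).
assert (Hu0 : 0 < u0) by (apply Rdiv_lt_0_compat; lra).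
set (G := fun u => wsum l (fun x => ln (1 + x * u) * Rpower u (- t - 1))).
assert (GE : forall u, G u = Rpower u (- t - 1) * wsum l (fun x => ln (1 + x * u))).
{ intros u; rewrite <- wsum_scal; unfold G; induction l; simpl; auto.
  clear - IHl; f_equal; [ring|]; clear; induction l; simpl; auto; rewrite IHl; ring. }
assert (G0 : forall u, 0 < u -> 0 <= G u).
{ intros u Hu; rewrite GE; apply Rmult_le_pos; [apply Rlt_le, exp_pos | auto]. }
assert (G1 : forall u, 0 < u <= u0 -> 0 < G u).
{ intros u Hu; rewrite GE; apply Rmult_lt_0_compat; [apply exp_pos|].
  destruct (wsum_perturb l (fun x => ln (1 + x * u))
    (fun x => u * x - u ^ 2 / 2 * x ^ 2) (fun x => u ^ 3 * (x ^ 3 / 3))) as [B _].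
  - intros p Hp; generalize (Hx p Hp); intros Hp0.
    assert (Hpu : 0 <= snd p * u) by (apply Rmult_le_pos; lra).
    generalize (ln1p_lower _ Hpu), (ln1p_upper _ Hpu); intros.
    replace (u ^ 3 * (snd p ^ 3 / 3)) with ((snd p * u) ^ 3 / 3) by field.
    replace (u * snd p - u ^ 2 / 2 * snd p ^ 2)
      with (snd p * u - (snd p * u) ^ 2 / 2) by field.
    assert (0 <= (snd p * u) ^ 3) by (apply pow_le; auto).
    apply Rabs_le; lra.
  - eapply Rlt_le_trans; [|exact B].
    rewrite wsum_abs_scal, wsum_minus, !wsum_scal, H1.
    change (wsum_abs l (fun x => x ^ 3 / 3)) with K.
    assert (0 < u ^ 2) by (apply pow_lt; lra).
    assert (u * K <= m / 3).
    { apply Rle_trans with (u0 * (K + 1)).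
      - apply Rmult_le_compat; lra.
      - unfold u0; right; field; lra. }
    replace (u * 0 - u ^ 2 / 2 * wsum l (fun x : R => x ^ 2) - u ^ 3 * K)
      with (u ^ 2 * (m / 2 - u * K)) by (unfold m; field).
    apply Rmult_lt_0_compat; lra. }
assert (GI : forall a b, 0 < a -> 0 < b -> is_RInt G a b
   (wsum l (fun x => Rpower x t * (stieltjes_primitive t (x * b) - stieltjes_primitive t (x * a))))).
{ intros a b Ha Hb; apply (wsum_is_RInt l (fun x u => ln (1 + x * u) * Rpower u (- t - 1))).
  intros p Hp; apply stieltjes_kernel_scaled; auto. }
(* Since G is nonnegative, this positive number bounds from below every integral of G over an
   interval containing [u0 / 2, u0]. *)
set (k := RInt G (u0 / 2) u0).
assert (Hk : 0 < k).
{ apply RInt_gt_0; [lra | intros u Hu; apply G1; lra|].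
  intros u Hu; apply @ex_derive_continuous.
  unfold G; clearbody u0; clear - Hu Hu0 Hx; induction l as [|p l IH]; simpl.
  - apply ex_derive_const.
  - apply @ex_derive_plus; [|apply IH; intros; apply Hx; simpl; auto].
    generalize (Hx p (or_introl eq_refl)); intros; unfold Rpower.
    auto_derive; repeat split; auto; try lra.
    assert (0 < snd p * u) by (apply Rmult_lt_0_compat; lra); lra. }
destruct (stieltjes_primitive_limit t Ht) as [c [Hc HL]].
set (W := wsum_abs l (fun x => Rpower x t)).
assert (HW : 0 <= W) by (apply wsum_abs_nonneg; intros; apply Rlt_le, exp_pos).
(* Replacing the truncated integrals by their limit [c] changes the sum by at most e W <= k / 2, so
   a positive part of [k] survives. *)
set (e := k / (2 * (W + 1))).
assert (He : 0 < e) by (apply Rdiv_lt_0_compat; lra).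
assert (U : exists L0, 0 < L0 /\ forall L, L0 <= L -> forall p, In p l ->
  Rabs (stieltjes_primitive t (snd p * L) - stieltjes_primitive t (snd p / L) - c) <= e).
{ clearbody e; clear - Hx HL He; induction l as [|p l IH].
  - exists 1; split; [lra|]; intros L _ p [].
  - destruct IH as [La [HLa Ha]].
    { intros; apply Hx; simpl; auto. }
    destruct (HL (snd p) e) as [Lb [HLb Hb]]; auto.
    { apply Hx; simpl; auto. }
    exists (Rmax La Lb); split.
    { apply Rlt_le_trans with La; auto; apply Rmax_l. }
    intros L HLL q [<- | Hq].
    + apply Hb; generalize (Rmax_r La Lb); lra.
    + apply Ha; auto; generalize (Rmax_l La Lb); lra. }
destruct U as [L0 [HL0 U]].
(* Large enough for the uniform approximation and for [1 / L, L] to contain [u0 / 2, u0]. *)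
set (L := Rmax L0 (Rmax u0 (/ (u0 / 2)))).
assert (HLL : L0 <= L /\ u0 <= L /\ / (u0 / 2) <= L).
{ unfold L; generalize (Rmax_l L0 (Rmax u0 (/ (u0 / 2)))), (Rmax_r L0 (Rmax u0 (/ (u0 / 2)))),
    (Rmax_l u0 (/ (u0 / 2))), (Rmax_r u0 (/ (u0 / 2))); lra. }
destruct HLL as [La [Lb Lc]].
assert (HL' : 0 < / L) by (apply Rinv_0_lt_compat; lra).
assert (Ld : / L <= u0 / 2).
{ rewrite <- (Rinv_inv (u0 / 2)); apply Rinv_le_contravar; auto.
  apply Rinv_0_lt_compat; lra. }
assert (EX : forall a b, 0 < a -> 0 < b -> ex_RInt G a b) by (intros; eexists; apply GI; auto).
assert (HI : k <= RInt G (/ L) L).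
{ rewrite <- (RInt_Chasles G (/ L) (u0 / 2) L) by (apply EX; lra).
  rewrite <- (RInt_Chasles G (u0 / 2) u0 L) by (apply EX; lra).
  unfold plus; simpl; fold k.
  assert (0 <= RInt G (/ L) (u0 / 2))
    by (apply RInt_ge_0; [lra | apply EX; lra | intros; apply G0; lra]).
  assert (0 <= RInt G u0 L)
    by (apply RInt_ge_0; [lra | apply EX; lra | intros; apply G0; lra]).
  lra. }
rewrite (is_RInt_unique _ _ _ _ (GI (/ L) L HL' ltac:(lra))) in HI.
destruct (wsum_perturb l
  (fun x => Rpower x t * (stieltjes_primitive t (x * L) - stieltjes_primitive t (x * / L)))
  (fun x => c * Rpower x t) (fun x => e * Rpower x t)) as [_ B].
{ intros p Hp.
  replace (Rpower (snd p) t * (stieltjes_primitive t (snd p * L) - stieltjes_primitive t (snd p * / L))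
           - c * Rpower (snd p) t)
    with (Rpower (snd p) t * (stieltjes_primitive t (snd p * L) - stieltjes_primitive t (snd p / L) - c))
    by (unfold Rdiv; ring).
  rewrite Rabs_mult, Rabs_right by (apply Rle_ge, Rlt_le, exp_pos).
  rewrite (Rmult_comm e); apply Rmult_le_compat_l; [apply Rlt_le, exp_pos | auto]. }
rewrite wsum_scal, wsum_abs_scal in B; fold W in B.
assert (e * W <= k / 2).
{ apply Rle_trans with (e * (W + 1)); [apply Rmult_le_compat_l; lra|].
  unfold e; right; field; lra. }
apply Rmult_lt_reg_l with c; auto; lra.
Qed.

(** * Weighted AM-GM for a single measurement outcome *)

Lemma weighted_am_gm (a x y : R) : 0 < a < 1 -> 0 < x -> 0 < y ->
  Rpower x a * Rpower y (1 - a) <= a * x + (1 - a) * y.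
Proof.
intros Ha Hx Hy; unfold Rpower; rewrite <- exp_plus.
set (z := a * x + (1 - a) * y).
assert (Px : 0 < a * x) by (apply Rmult_lt_0_compat; lra).
assert (Py : 0 < (1 - a) * y) by (apply Rmult_lt_0_compat; lra).
assert (Hz : 0 < z) by (unfold z; lra).
rewrite <- (exp_ln z) by auto.
assert (Lx := ln_le_sub1 (x / z) ltac:(apply Rdiv_lt_0_compat; auto)).
assert (Ly := ln_le_sub1 (y / z) ltac:(apply Rdiv_lt_0_compat; auto)).
rewrite ln_div in Lx, Ly by auto.
apply Rmult_le_compat_l with (r := a) in Lx; [|lra].
apply Rmult_le_compat_l with (r := 1 - a) in Ly; [|lra].
assert (E : a * (x / z - 1) + (1 - a) * (y / z - 1) = 0) by (unfold z; field; fold z; lra).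
destruct (Rle_lt_or_eq_dec (a * ln x + (1 - a) * ln y) (ln z)) as [H | H]; [lra| |].
- apply Rlt_le, exp_increasing; auto.
- rewrite H; lra.
Qed.

(** AM-GM for p / b and q b^(a/(1-a)): in the weighted geometric mean the powers of [b] cancel. The
    free parameter [b] will be the eigenvalue of K belonging to the outcome. *)
Lemma measured_am_gm (a p q b : R) : 0 < a < 1 -> 0 < p -> 0 < q -> 0 < b ->
  Rpower p a * Rpower q (1 - a) <= a * (p / b) + (1 - a) * (q * Rpower b (a / (1 - a))).
Proof.
intros Ha Hp Hq Hb.
assert (Hc : 0 < Rpower b (a / (1 - a))) by apply exp_pos.
replace (Rpower p a * Rpower q (1 - a))
  with (Rpower (p / b) a * Rpower (q * Rpower b (a / (1 - a))) (1 - a)).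
- apply weighted_am_gm; auto; [apply Rdiv_lt_0_compat | apply Rmult_lt_0_compat]; auto.
- unfold Rpower at 1 2 4 5; rewrite <- !exp_plus, ln_div, ln_mult by auto.
  unfold Rpower; rewrite ln_exp; f_equal; field; lra.
Qed.

Lemma scaled_ln_lt (a x y : R) : a < 1 -> 0 < x < y -> / (a - 1) * ln y < / (a - 1) * ln x.
Proof.
intros Ha Hxy; apply Rmult_lt_gt_compat_neg_l.
- apply Rinv_lt_0_compat; lra.
- apply ln_increasing; lra.
Qed.

Close Scope R_scope.
From HB Require Import structures.
From mathcomp Require Import all_boot all_order all_algebra.
From mathcomp Require Import Rstruct complex spectral sesquilinear.
From mathcomp Require Import ring lra.
From mathcomp Require Import all_classical all_reals topology normedtype derive Rstruct_topology.
Require Import Defs.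
Set Implicit Arguments. Unset Strict Implicit. Unset Printing Implicit Defensive.
Import Order.TTheory GRing.Theory Num.Theory numFieldNormedType.Exports.
Local Open Scope ring_scope.
Local Open Scope complex_scope.

(** * Complex matrices *)

Section ComplexMatrices.
Variable R : rcfType.
Local Notation CC := (complex R).

Definition ctr (m n : nat) (A : 'M[CC]_(m, n)) : 'M[CC]_(n, m) := (map_mx conjc A)^T.

Lemma ctrE (m n : nat) (A : 'M[CC]_(m, n)) i j : ctr A i j = conjc (A j i).
Proof. by rewrite !mxE. Qed.

Lemma ctrK (m n : nat) (A : 'M[CC]_(m, n)) : ctr (ctr A) = A.
Proof. by apply/matrixP => i j; rewrite !ctrE conjcK. Qed.

Lemma ctrM (m n p : nat) (A : 'M[CC]_(m, n)) (B : 'M[CC]_(n, p)) :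
  ctr (A *m B) = ctr B *m ctr A.
Proof. by rewrite /ctr map_mxM trmx_mul. Qed.

Lemma ctrD (m n : nat) (A B : 'M[CC]_(m, n)) : ctr (A + B) = ctr A + ctr B.
Proof. by rewrite /ctr map_mxD linearD. Qed.

Lemma ctrB (m n : nat) (A B : 'M[CC]_(m, n)) : ctr (A - B) = ctr A - ctr B.
Proof. by rewrite /ctr map_mxB linearB. Qed.

Lemma ctr1 (n : nat) : ctr (1%:M : 'M[CC]_n) = 1%:M.
Proof. by rewrite /ctr map_mx1 trmx1. Qed.

Lemma realcM (x y : R) : (x * y)%:C = x%:C * y%:C.
Proof. exact: rmorphM. Qed.

Lemma realcD (x y : R) : (x + y)%:C = x%:C + y%:C.
Proof. exact: rmorphD. Qed.

Definition normsq (z : CC) : R := complex.Re z ^+ 2 + complex.Im z ^+ 2.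

Lemma normsqE (z : CC) : z * conjc z = (normsq z)%:C.
Proof.
case: z => x y; rewrite /normsq /=; apply/eqP; rewrite eq_complex /=.
by apply/andP; split; apply/eqP; ring.
Qed.

Lemma normsqE' (z : CC) : conjc z * z = (normsq z)%:C.
Proof. by rewrite mulrC normsqE. Qed.

Lemma normsq_ge0 (z : CC) : 0 <= normsq z.
Proof. by rewrite addr_ge0 ?sqr_ge0. Qed.

Lemma normsq_eq0 (z : CC) : (normsq z == 0) = (z == 0).
Proof. by rewrite paddr_eq0 ?sqr_ge0 // !sqrf_eq0 eq_complex. Qed.

Definition uni (n : nat) (U : 'M[CC]_n) := ctr U *m U = 1%:M.

Lemma uniC (n : nat) (U : 'M[CC]_n) : uni U -> U *m ctr U = 1%:M.
Proof. exact: mulmx1C. Qed.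

Lemma uni1 (n : nat) : uni (1%:M : 'M[CC]_n).
Proof. by rewrite /uni ctr1 mul1mx. Qed.

Lemma uni_ctr (n : nat) (U : 'M[CC]_n) : uni U -> uni (ctr U).
Proof. by move=> /uniC; rewrite /uni ctrK. Qed.

Lemma uniM (n : nat) (U V : 'M[CC]_n) : uni U -> uni V -> uni (U *m V).
Proof. by move=> u v; rewrite /uni ctrM mulmxA -(mulmxA (ctr V)) u mulmx1 v. Qed.

Definition rdiag (n : nat) (f : 'I_n -> R) : 'M[CC]_n :=
  diag_mx (\row_i (f i)%:C).

(* Locked, as otherwise rewriting with [mulmxA] would unfold it to find a product. *)
Fact spec_key : unit. Proof. exact: tt. Qed.
Definition spec (n : nat) (U : 'M[CC]_n) (f : 'I_n -> R) : 'M[CC]_n :=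
  locked_with spec_key (U *m rdiag f *m ctr U).

Lemma spec_unfold (n : nat) (U : 'M[CC]_n) (f : 'I_n -> R) :
  spec U f = U *m rdiag f *m ctr U.
Proof. by rewrite /spec unlock. Qed.

Section Spec.
Variables (n : nat) (U : 'M[CC]_n).
Hypothesis unitU : uni U.

Lemma rdiagM (f g : 'I_n -> R) : rdiag f *m rdiag g = rdiag (fun i => f i * g i).
Proof.
rewrite /rdiag mulmx_diag; congr diag_mx; apply/rowP => i.
by rewrite !mxE rmorphM.
Qed.

Lemma rdiagD (f g : 'I_n -> R) : rdiag f + rdiag g = rdiag (fun i => f i + g i).
Proof.
by rewrite /rdiag -linearD; congr diag_mx; apply/rowP => i; rewrite !mxE rmorphD.
Qed.

Lemma rdiag_const (c : R) : rdiag (fun _ : 'I_n => c) = (c%:C)%:M.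
Proof.
by rewrite -diag_const_mx /rdiag; congr diag_mx; apply/rowP => i; rewrite !mxE.
Qed.

Lemma ctr_rdiag (f : 'I_n -> R) : ctr (rdiag f) = rdiag f.
Proof.
apply/matrixP => i j; rewrite !mxE eq_sym; case: eqP => [->|_].
  by rewrite !mulr1n conjc_real.
by rewrite !mulr0n conjc0.
Qed.

Lemma specM (f g : 'I_n -> R) : spec U f *m spec U g = spec U (fun i => f i * g i).
Proof.
rewrite !spec_unfold -rdiagM !mulmxA; congr (_ *m _ *m _).
by rewrite -!mulmxA unitU mulmx1.
Qed.

Lemma specD (f g : 'I_n -> R) : spec U f + spec U g = spec U (fun i => f i + g i).
Proof. by rewrite !spec_unfold -mulmxDl -mulmxDr rdiagD. Qed.

Lemma spec_const (c : R) : spec U (fun _ => c) = (c%:C)%:M.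
Proof.
by rewrite !spec_unfold rdiag_const scalar_mxC -mulmxA uniC // mulmx1.
Qed.

Lemma eq_spec (f g : 'I_n -> R) : f =1 g -> spec U f = spec U g.
Proof.
by move=> fg; rewrite !spec_unfold; congr (_ *m diag_mx _ *m _); apply/rowP => i; rewrite !mxE fg.
Qed.

Lemma ctr_spec (f : 'I_n -> R) : ctr (spec U f) = spec U f.
Proof. by rewrite !spec_unfold !ctrM ctrK ctr_rdiag mulmxA. Qed.

Lemma specE (f : 'I_n -> R) i j :
  spec U f i j = \sum_k (f k)%:C * (U i k * conjc (U j k)).
Proof.
rewrite spec_unfold mxE; apply: eq_bigr => k _.
by rewrite /rdiag mul_mx_diag !mxE mulrCA !mulrA (mulrC (U i k)).
Qed.

Lemma trace_spec (f : 'I_n -> R) : \tr (spec U f) = (\sum_k f k)%:C.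
Proof.
rewrite !spec_unfold mxtrace_mulC mulmxA unitU mul1mx mxtrace_diag rmorph_sum /=.
by apply: eq_bigr => i _; rewrite mxE.
Qed.

Lemma det_spec (f : 'I_n -> R) : \det (spec U f) = (\prod_k f k)%:C.
Proof.
rewrite !spec_unfold !det_mulmx mulrAC -det_mulmx uniC // det1 mul1r det_diag rmorph_prod /=.
by apply: eq_bigr => i _; rewrite mxE.
Qed.

Definition form (Z : 'M[CC]_n) (x y : 'cV[CC]_n) : CC := (ctr x *m Z *m y) 0 0.

Lemma form_spec (f : 'I_n -> R) (x : 'cV[CC]_n) :
  form (spec U f) x x = (\sum_j f j * normsq ((ctr U *m x) j 0))%:C.
Proof.
rewrite /form !spec_unfold !mulmxA -mulmxA -mulmxA -[ctr x *m U]ctrK ctrM ctrK.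
move: (ctr U *m x) => y; rewrite mulmxA mxE rmorph_sum /=; apply: eq_bigr => j _.
by rewrite /rdiag mul_mx_diag mxE ctrE mxE realcM -normsqE' mulrA (mulrC (conjc _)).
Qed.

End Spec.

Lemma spec1 (n : nat) (f : 'I_n -> R) : spec 1%:M f = rdiag f.
Proof. by rewrite !spec_unfold ctr1 mulmx1 mul1mx. Qed.

(** The perturbation is a rank-one product u v. Factoring the block matrix with rows (1, -u) and (v,
    1) in two ways gives det (1 + u v) = 1 + v u. *)
Lemma det_add_delta (n : nat) (G : 'M[CC]_n) (i : 'I_n) (c : CC) :
  \det (1%:M + c *: (delta_mx i i *m G)) = 1 + c * G i i.
Proof.
set u : 'cV[CC]_n := delta_mx i 0; set v : 'rV[CC]_n := c *: row i G.
have -> : c *: (delta_mx i i *m G) = u *m v.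
  by rewrite /u /v -scalemxAr; congr (_ *: _); rewrite rowE mulmxA mul_delta_mx.
have E1 : block_mx 1%:M (- u) v 1%:M =
    block_mx 1%:M 0 v 1%:M *m block_mx 1%:M (- u) 0 (1%:M + v *m u).
  by rewrite mulmx_block !(mul0mx, mul1mx, mulmx1, mulmx0, addr0, mulmxN) addrCA addNr addr0.
have E2 : block_mx 1%:M (- u) v 1%:M =
    block_mx (1%:M + u *m v) (- u) 0 1%:M *m block_mx 1%:M 0 v 1%:M.
  by rewrite mulmx_block !(mul0mx, mul1mx, mulmx1, mulmx0, addr0, mulNmx, add0r) addrK.
have := congr1 determinant E1; rewrite E2 !det_mulmx !det_ublock !det_lblock !det1 !(mulr1, mul1r).
move=> ->; rewrite det_mx11 mxE [X in X + _]mxE; congr (_ + _).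
rewrite /v /u -scalemxAl mxE; congr (_ * _).
by rewrite -colE !mxE.
Qed.

Lemma formB (n : nat) (Y X : 'M[CC]_n) (u : 'cV[CC]_n) :
  form (Y - X) u u = form Y u u - form X u u.
Proof.
rewrite /form mulmxBr mulmxBl.
by move: (ctr u *m Y *m u) (ctr u *m X *m u) => P Q; rewrite !mxE.
Qed.

Lemma form_rdiag (n : nat) (f : 'I_n -> R) (x : 'cV[CC]_n) :
  form (rdiag f) x x = (\sum_j f j * normsq (x j 0))%:C.
Proof. by rewrite -spec1 form_spec ?ctr1 ?mul1mx //; exact: uni1. Qed.

Lemma delta_form (n : nat) (Z : 'M[CC]_n) (i : 'I_n) :
  (ctr (delta_mx i 0 : 'cV[CC]_n) *m (Z *m (delta_mx i 0 : 'cV[CC]_n))) 0 0 = Z i i.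
Proof.
rewrite -colE mxE (bigD1 i) //= big1 ?addr0 => [|k ki].
  by rewrite ctrE !mxE !eqxx conjc1 mul1r.
by rewrite ctrE !mxE (negbTE ki) conjc0 mul0r.
Qed.

(* With [X w = e] and [Y u = e], the positivity of [X] at [w - u] and [X <= Y] give [<e, X^-1 e> >= <e, Y^-1 e>]. *)
Lemma inverse_antitone (n : nat) (X Y : 'M[CC]_n) (w u e : 'cV[CC]_n) (p q : R) :
  ctr X = X -> X *m w = e -> Y *m u = e ->
  form X (w - u) (w - u) = p%:C -> 0 <= p ->
  form Y u u - form X u u = q%:C -> 0 <= q ->
  complex.Re ((ctr e *m u) 0 0) <= complex.Re ((ctr e *m w) 0 0).
Proof.
move=> hX Xw Yu Ep p0 Eq q0.
have we : (ctr w *m e) 0 0 = conjc ((ctr e *m w) 0 0).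
  by rewrite -ctrE ctrM ctrK.
have : (p + q)%:C = conjc ((ctr e *m w) 0 0) - (ctr e *m u) 0 0.
  rewrite -we rmorphD /= -Ep -Eq /form ctrB mulmxBl !mulmxBr !mulmxBl.
  rewrite -!mulmxA Xw Yu -Xw ctrM hX -!mulmxA !mxE.
  by rewrite !opprB; ring.
case: ((ctr e *m w) 0 0) => x1 y1; case: ((ctr e *m u) 0 0) => x2 y2 /=.
move/eqP; rewrite eq_complex /= => /andP[/eqP E _].
by rewrite -subr_ge0 -E addr_ge0.
Qed.

(** Write A = [rdiag a], B = [spec T b] and E for the matrix unit at (i, i). Then 1 + (A + dl E) B =
    (1 + dl E G) (1 + A B) with G = B (1 + A B)^-1 = (B^-1 + A)^-1, so the determinant gains the
    factor 1 + dl G_ii, and [g] is G_ii. Since A <= M, B^-1 + A lies below B^-1 + M, and inverse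
    antitonicity bounds G_ii from below by the same entry of (B^-1 + M)^-1. *)
Lemma det_rdiag_step (n : nat) (T : 'M[CC]_n) (b a : 'I_n -> R) (i : 'I_n) (M dl r : R) :
  uni T -> (forall j, 0 < b j) -> (forall k, 0 <= a k <= M) -> 0 < r ->
  \det (1%:M + rdiag a *m spec T b) = r%:C ->
  exists2 g, \sum_j normsq (T i j) * (b j / (1 + M * b j)) <= g &
    \det (1%:M + rdiag (fun k => a k + dl * (k == i)%:R) *m spec T b)
      = (r * (1 + dl * g))%:C.
Proof.
move=> uT b0 aM r0 Er.
have M0 : 0 <= M by case/andP: (aM i) => ? ?; exact: le_trans (_ : a i <= M).
have b1 j : b j != 0 by rewrite gt_eqF.
have bM j : 0 < 1 + M * b j by rewrite ltr_pwDl // mulr_ge0 // ltW.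
set B := spec T b; set D := 1%:M + rdiag a *m B.
have uD : D \in unitmx.
  by rewrite unitmxE Er unitfE -(rmorph0 (real_complex R)) (inj_eq (@complexI _)) gt_eqF.
set G := B *m invmx D.
set X := spec T (fun j => (b j)^-1) + rdiag a.
have XG : X *m G = 1%:M.
  rewrite /G mulmxA mulmxDl specM //.
  rewrite (eq_spec T (g := fun=> 1)) ?spec_const //; last by move=> j; rewrite mulVf.
  by rewrite mulmxV.
have hX : ctr X = X by rewrite ctrD ctr_spec ctr_rdiag.
have formX x : form X x x = (\sum_j (b j)^-1 * normsq ((ctr T *m x) j 0)
     + \sum_j a j * normsq (x j 0))%:C.
  rewrite rmorphD /= -form_spec // -form_rdiag /form /X mulmxDr mulmxDl mxE //.
set e : 'cV[CC]_n := delta_mx i 0.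
set w := G *m e.
have Xw : X *m w = e by rewrite mulmxA XG mul1mx.
set h := fun j => b j / (1 + M * b j).
set Y := spec T (fun j => (b j)^-1) + rdiag (fun=> M).
set u := spec T h *m e.
have Yu : Y *m u = e.
  rewrite /Y rdiag_const -(spec_const uT) specD mulmxA specM //.
  rewrite (eq_spec T (g := fun=> 1)) ?spec_const ?mul1mx // => j; rewrite /h.
  have bMj : 1 + M * b j != 0 by rewrite gt_eqF.
  by have bj := b1 j; field; rewrite ?bj ?bMj.
have wG : (ctr e *m w) 0 0 = G i i by rewrite /w /e delta_form.
have ue : (ctr e *m u) 0 0 = (\sum_j normsq (T i j) * h j)%:C.
  rewrite /u /e delta_form specE rmorph_sum /=; apply: eq_bigr => j _.
  by rewrite normsqE -realcM mulrC.
(* Up to conjugation this entry is the quadratic form of X at [w], hence real. *)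
have Gr : G i i = (complex.Re (G i i))%:C.
  have : (ctr w *m e) 0 0 = conjc (G i i) by rewrite -wG -ctrE ctrM ctrK.
  rewrite -Xw mulmxA -/(form X w w) formX.
  by case: (G i i) => x y /eqP; rewrite eq_complex /= => /andP[_ /eqP E];
    rewrite -[y]opprK -E oppr0.
exists (complex.Re (G i i)).
  have <- : complex.Re ((ctr e *m u) 0 0) = \sum_j normsq (T i j) * h j by rewrite ue.
  rewrite -wG.
  apply: (inverse_antitone hX Xw Yu (formX _) _ (q := \sum_j (M - a j) * normsq (u j 0))).
  - apply: addr_ge0; apply: sumr_ge0 => j _; rewrite mulr_ge0 ?normsq_ge0 //.
      by rewrite invr_ge0 ltW.
    by case/andP: (aM j).
  - suff YX : Y - X = rdiag (fun j => M - a j).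
      by rewrite -form_rdiag -YX formB.
    by rewrite /Y /X opprD addrACA subrr add0r; apply/matrixP => k l; rewrite !mxE -mulrnBl rmorphB.
  - by apply: sumr_ge0 => j _; rewrite mulr_ge0 ?normsq_ge0 // subr_ge0; case/andP: (aM j).
have -> : rdiag (fun k => a k + dl * (k == i)%:R) = rdiag a + dl%:C *: delta_mx i i.
  apply/matrixP => k l; rewrite !mxE rmorphD rmorphM /= rmorph_nat mulrnDl; congr (_ + _).
  case: (k =P l) => [<-|kl]; rewrite ?andbb ?mulr1n //= ?mulr0n.
  by case: (k =P i) => [ki|_] /=; rewrite ?mulr0 // (_ : l == i = false) ?mulr0 //;
    apply/eqP => li; apply: kl; rewrite ki li.
have -> : 1%:M + (rdiag a + dl%:C *: delta_mx i i) *m B =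
          (1%:M + dl%:C *: (delta_mx i i *m G)) *m D.
  rewrite [in LHS]mulmxDl addrA [RHS]mulmxDl mul1mx -scalemxAl; congr (_ + _).
  by rewrite -scalemxAl /G mulmxA mulmxKV.
by rewrite det_mulmx Er det_add_delta realcM realcD realcM -Gr mulrC.
Qed.

End ComplexMatrices.

(** * Positive definite matrices, spectral calculus and traces *)

Section PositiveMatrices.
Variable R : rcfType.
Local Notation CC := (complex R).

Lemma hermitian_spec (n : nat) (A : 'M[CC]_n) : ctr A = A ->
  exists U f, uni U /\ A = spec U f.
Proof.
move=> hA.
have conjE m1 m2 (B : 'M[CC]_(m1, m2)) : (map_mx Num.conj B)^T = ctr B.
  by apply/matrixP => i j; rewrite !mxE.
have herm : A \is hermsymmx.
  by apply/is_hermitianmxP; rewrite expr0 scale1r -map_trmx conjE.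
have norm := hermitian_normalmx herm.
have /orthomx_spectralP E := norm.
have uP := spectral_unitarymx A.
have /mxOverP real := hermitian_spectral_diag_real herm.
have iP : invmx (spectralmx A) = ctr (spectralmx A).
  by rewrite invmx_unitary // -conjE map_trmx.
(* The spectral theorem gives A = P^-1 D P with P unitary, so U is the adjoint of P. D is real, so
   taking real parts loses nothing. *)
exists (ctr (spectralmx A)), (fun i => complex.Re (spectral_diag A 0 i)); split.
  rewrite /uni ctrK -conjE map_trmx; exact/unitarymxP.
rewrite {1}E iP !spec_unfold ctrK; congr (_ *m diag_mx _ *m _).
apply/rowP => i; rewrite mxE.
by have := real 0 i; case: (spectral_diag A 0 i) => x y; rewrite complex_real /= => /eqP ->.
Qed.

Definition pdm (n : nat) (Z : 'M[CC]_n) :=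
  ctr Z = Z /\ forall x : 'cV[CC]_n, x != 0 -> 0 < complex.Re (form Z x x).

Lemma uni_unit (n : nat) (U : 'M[CC]_n) : uni U -> U \in unitmx.
Proof. by move=> /mulmx1_unit[]. Qed.

Lemma unitmx_mul_neq0 (n : nat) (S : 'M[CC]_n) (x : 'cV[CC]_n) :
  S \in unitmx -> x != 0 -> S *m x != 0.
Proof. by move=> uS; apply: contra => /eqP E; rewrite -(mulKmx uS x) E mulmx0. Qed.

Lemma pdm_spec (n : nat) (U : 'M[CC]_n) (f : 'I_n -> R) :
  uni U -> (forall i, 0 < f i) -> pdm (spec U f).
Proof.
move=> uU f0; split=> [|x x0]; first exact: ctr_spec.
have ux := unitmx_mul_neq0 (uni_unit (uni_ctr uU)) x0.
rewrite form_spec //=.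
have pos j : 0 <= f j * normsq ((ctr U *m x) j 0) by rewrite mulr_ge0 ?normsq_ge0 // ltW.
rewrite lt_def sumr_ge0 // andbT; apply: contra ux => /eqP E.
apply/eqP/colP => j; rewrite [RHS]mxE; apply/eqP; rewrite -normsq_eq0.
have /eqP := E; rewrite psumr_eq0 // => /allP /(_ j); rewrite mem_index_enum => /(_ isT) /=.
by rewrite mulf_eq0 gt_eqF.
Qed.

Lemma pdm_congr (n : nat) (S Z : 'M[CC]_n) : S \in unitmx -> pdm Z ->
  pdm (ctr S *m Z *m S).
Proof.
move=> uS [hZ pZ]; split=> [|x x0]; first by rewrite !ctrM ctrK hZ mulmxA.
have := pZ _ (unitmx_mul_neq0 uS x0).
by rewrite /form ctrM !mulmxA.
Qed.

Lemma delta_neq0 (n : nat) (k : 'I_n) : (delta_mx k 0 : 'cV[CC]_n) != 0.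
Proof.
by apply/eqP => /colP /(_ k); rewrite !mxE !eqxx; apply/eqP; exact: oner_neq0.
Qed.

Lemma pdm_diag (n : nat) (Z : 'M[CC]_n) (k : 'I_n) : pdm Z -> 0 < complex.Re (Z k k).
Proof. by case=> _ /(_ _ (delta_neq0 k)); rewrite /form -mulmxA delta_form. Qed.

Lemma spec_diag (n : nat) (U : 'M[CC]_n) (f : 'I_n -> R) : uni U ->
  ctr U *m spec U f *m U = rdiag f.
Proof. by move=> uU; rewrite !spec_unfold !mulmxA uU mul1mx -mulmxA uU mulmx1. Qed.

Lemma pdm_spec_gt0 (n : nat) (U : 'M[CC]_n) (f : 'I_n -> R) (k : 'I_n) :
  uni U -> pdm (spec U f) -> 0 < f k.
Proof.
move=> uU /(pdm_congr (uni_unit uU)); rewrite spec_diag // => /(pdm_diag k).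
by rewrite !mxE eqxx mulr1n.
Qed.

Lemma spec_ctrM (n : nat) (V W : 'M[CC]_n) (f : 'I_n -> R) :
  spec (ctr V *m W) f = ctr V *m spec W f *m V.
Proof. by rewrite !spec_unfold ctrM ctrK !mulmxA. Qed.

Lemma specZ (n : nat) (U : 'M[CC]_n) (f : 'I_n -> R) (c : R) :
  spec U (fun i => f i * c) = c%:C *: spec U f.
Proof.
apply/matrixP => i j; rewrite [RHS]mxE !specE mulr_sumr; apply: eq_bigr => k _.
by rewrite realcM [_ * c%:C]mulrC -mulrA.
Qed.

Lemma specV (n : nat) (U : 'M[CC]_n) (f : 'I_n -> R) : uni U -> (forall i, 0 < f i) ->
  spec U f *m spec U (fun i => (f i)^-1) = 1%:M.
Proof.
move=> uU f0; rewrite specM // (eq_spec U (g := fun=> 1)) ?spec_const // => i.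
by rewrite mulfV // gt_eqF.
Qed.

Lemma spec_unitmx (n : nat) (U : 'M[CC]_n) (f : 'I_n -> R) :
  uni U -> (forall i, 0 < f i) -> spec U f \in unitmx.
Proof. by move=> uU f0; have [uS _] := mulmx1_unit (specV uU f0). Qed.

(** In the eigenbasis, commuting with diag f forces the entries of X to vanish wherever f i and f j
    differ; elsewhere g i = g j. This lets commutation pass between different powers of one
    matrix. *)
Lemma comm_spec (n : nat) (U X : 'M[CC]_n) (f g : 'I_n -> R) : uni U ->
  (forall i j, f i = f j -> g i = g j) ->
  X *m spec U f = spec U f *m X -> X *m spec U g = spec U g *m X.
Proof.
move=> uU fg E.
pose Y := ctr U *m X *m U.
have XE : X = U *m Y *m ctr U.
  by rewrite /Y !mulmxA uniC // mul1mx -mulmxA uniC // mulmx1.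
have Yf : Y *m rdiag f = rdiag f *m Y.
  rewrite -(spec_diag f uU) /Y; move: (spec U f) E => F E.
  have -> : ctr U *m X *m U *m (ctr U *m F *m U) = ctr U *m (X *m F) *m U.
    by rewrite !mulmxA -(mulmxA (ctr U *m X) U) uniC // mulmx1.
  by rewrite E !mulmxA -(mulmxA (ctr U *m F) U) uniC // mulmx1.
have Yg : Y *m rdiag g = rdiag g *m Y.
  apply/matrixP => i j; have /matrixP /(_ i j) := Yf.
  clearbody Y; rewrite /rdiag !mul_mx_diag !mul_diag_mx !mxE.
  have [fij _|nf] := eqVneq (f i) (f j); first by rewrite (fg _ _ fij) mulrC.
  rewrite (mulrC _ (f j)%:C) => /eqP; rewrite -subr_eq0 -mulrBl mulf_eq0.
  case/orP => [|/eqP ->]; last by rewrite mul0r mulr0.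
  by rewrite subr_eq0 (inj_eq (@complexI R)) eq_sym (negbTE nf).
rewrite XE !spec_unfold; clearbody Y; move: (rdiag g) Yg => D Yg.
have -> : U *m Y *m ctr U *m (U *m D *m ctr U) = U *m (Y *m D) *m ctr U.
  by rewrite !mulmxA -(mulmxA (U *m Y) (ctr U)) uU mulmx1.
by rewrite Yg !mulmxA -(mulmxA (U *m D) (ctr U)) uU mulmx1.
Qed.

Lemma trace_ctr (n : nat) (Z : 'M[CC]_n) :
  \tr (ctr Z *m Z) = (\sum_i \sum_j normsq (Z j i))%:C.
Proof.
rewrite /mxtrace rmorph_sum; apply: eq_bigr => i _.
rewrite mxE rmorph_sum; apply: eq_bigr => j _ /=.
by rewrite ctrE normsqE'.
Qed.

Lemma trace_ctr_gt0 (n : nat) (Z : 'M[CC]_n) : Z != 0 ->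
  0 < complex.Re (\tr (ctr Z *m Z)).
Proof.
rewrite trace_ctr /= => Z0.
have p i : 0 <= \sum_j normsq (Z j i) by apply: sumr_ge0 => j _; exact: normsq_ge0.
rewrite lt_def sumr_ge0 // andbT; apply: contra Z0 => E.
apply/eqP/matrixP => i j; rewrite mxE; apply/eqP; rewrite -normsq_eq0.
move: E; rewrite psumr_eq0 // => /allP /(_ j); rewrite mem_index_enum => /(_ isT) /=.
rewrite psumr_eq0 => [/allP /(_ i)|k _]; last exact: normsq_ge0.
by rewrite mem_index_enum => /(_ isT).
Qed.

Lemma trace_rdiag_spec (n : nat) (T : 'M[CC]_n) (a f : 'I_n -> R) :
  \tr (rdiag a *m spec T f) = (\sum_i \sum_j normsq (T i j) * (a i * f j))%:C.
Proof.
rewrite /mxtrace rmorph_sum; apply: eq_bigr => i _.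
rewrite /rdiag mul_diag_mx mxE specE mxE rmorph_sum mulr_sumr; apply: eq_bigr => j _ /=.
by rewrite normsqE -!realcM; congr (_%:C); ring.
Qed.

(** Turns a weighted sum of outcome probabilities in the basis W into a trace, by cyclicity. *)
Lemma trace_spec_diag (n : nat) (W Z : 'M[CC]_n) (f : 'I_n -> R) :
  \sum_j f j * complex.Re ((ctr W *m Z *m W) j j) = complex.Re (\tr (Z *m spec W f)).
Proof.
have -> : \tr (Z *m spec W f) = \tr (ctr W *m Z *m W *m rdiag f).
  by rewrite !spec_unfold !mulmxA [LHS]mxtrace_mulC !mulmxA.
move: (ctr W *m Z *m W) => Y; rewrite /mxtrace raddf_sum; apply: eq_bigr => j _.
rewrite /rdiag mul_mx_diag !mxE /=.
by case: (Y j j) => x y /=; rewrite mulr0 subr0 mulrC.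
Qed.

(** Twice the difference of the two sides is the squared Hilbert-Schmidt norm of the nonzero
    commutator A B - B A. *)
Lemma trace_comm_lt (n : nat) (A B : 'M[CC]_n) : ctr A = A -> ctr B = B ->
  A *m B <> B *m A ->
  complex.Re (\tr (A *m B *m A *m B)) < complex.Re (\tr (A *m A *m (B *m B))).
Proof.
move=> hA hB AB.
have Z0 : A *m B - B *m A != 0 by rewrite subr_eq0; apply/eqP.
have := trace_ctr_gt0 Z0.
have trB (P Q P' Q' : 'M[CC]_n) : \tr (P - Q - (P' - Q')) = \tr P - \tr Q - (\tr P' - \tr Q').
  by rewrite !raddfB.
rewrite ctrB !ctrM hA hB mulmxBl !mulmxBr trB !mulmxA.
have -> : \tr (B *m A *m A *m B) = \tr (A *m A *m B *m B).
  by rewrite -!mulmxA mxtrace_mulC !mulmxA.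
have -> : \tr (A *m B *m B *m A) = \tr (A *m A *m B *m B).
  by rewrite mxtrace_mulC !mulmxA.
have -> : \tr (B *m A *m B *m A) = \tr (A *m B *m A *m B).
  by rewrite mxtrace_mulC !mulmxA.
by move: (\tr _) (\tr _) => [x1 y1] [x2 y2] /=; lra.
Qed.

End PositiveMatrices.

Local Notation R := Rdefinitions.R.
Local Notation CC := (complex R).
Local Arguments ln _%_R.
Local Arguments Rpower _%_R _%_R.

(** * The Araki-Lieb-Thirring inequality *)

Lemma lnM (x y : R) : 0 < x -> 0 < y -> ln (x * y) = ln x + ln y.
Proof. by move=> /RltP x0 /RltP y0; exact: ln_mult. Qed.

Lemma ln_decrementE (b M e : R) : 0 < b -> 0 <= e <= M ->
  ln (1 + M * b) <= ln (1 + (M - e) * b) + e * (b / (1 + M * b)) + e ^+ 2 * b ^+ 2.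
Proof.
move=> /RltP b0 /andP[/RleP e0 /RleP eM]; rewrite -!RpowE.
by apply/RleP; exact: ln_decrement b0 (conj e0 eM).
Qed.

Lemma ln_incrementE (u v : R) : 0 <= u -> u <= v -> u - u ^+ 2 <= ln (1 + v).
Proof.
move=> /RleP u0 /RleP uv; rewrite -!RpowE.
by apply/RleP; exact: ln_increment (conj u0 uv).
Qed.

Lemma sum_normsq_row (n : nat) (T : 'M[CC]_n) (i : 'I_n) : uni T ->
  \sum_j normsq (T i j) = 1.
Proof.
move=> /uniC /matrixP /(_ i i); rewrite !mxE eqxx mulr1n => E.
apply: (@complexI R); rewrite rmorph_sum rmorph1 -E /=; apply: eq_bigr => j _.
by rewrite ctrE normsqE.
Qed.

Section LogDet.
Variables (n : nat) (T : 'M[CC]_n) (b : 'I_n -> R).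
Hypotheses (uT : uni T) (b0 : forall j, 0 < b j).

(** The diagonal entry (i, i) of ln (1 + x B) for B = [spec T b]. *)
Definition diag_ln (i : 'I_n) (x : R) : R :=
  \sum_j normsq (T i j) * ln (1 + x * b j).

Lemma diag_ln0 (i : 'I_n) : diag_ln i 0 = 0.
Proof. by rewrite /diag_ln big1 // => j _; rewrite mul0r addr0 ln_1 mulr0. Qed.

(* Lowering the largest entry [M] of [a] by [e] divides the determinant by [1 + e G_ii], where [G_ii] dominates its value at the scalar matrix [M]. *)
Lemma logdet_grid (beta dl : R) (N : nat) : 0 <= dl -> (forall j, b j <= beta) ->
  forall (k : 'I_n -> nat) (a : 'I_n -> R),
  (\sum_i k i)%N = N -> (forall i, 0 <= a i <= (k i)%:R * dl) ->
  exists r : R, [/\ 0 < r, \det (1%:M + rdiag a *m spec T b) = r%:C &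
    \sum_i diag_ln i (a i) <= ln r + N%:R * (2 * dl ^+ 2 * beta ^+ 2)].
Proof.
move=> dl0 bbeta.
have err0 : 0 <= 2 * dl ^+ 2 * beta ^+ 2.
  exact: mulr_ge0 (mulr_ge0 (ler0n _ 2) (sqr_ge0 _)) (sqr_ge0 _).
have zero (a : 'I_n -> R) (m : nat) : (forall i, a i = 0) ->
  exists r : R, [/\ 0 < r, \det (1%:M + rdiag a *m spec T b) = r%:C &
    \sum_i diag_ln i (a i) <= ln r + m%:R * (2 * dl ^+ 2 * beta ^+ 2)].
  move=> a0; exists 1; split=> //.
    rewrite (_ : rdiag a = 0) ?mul0mx ?addr0 ?det1 //.
    by apply/matrixP => i j; rewrite !mxE a0 mul0rn.
  rewrite big1 => [|i _]; last by rewrite a0 diag_ln0.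
  by rewrite ln_1 add0r mulr_ge0.
elim: N => [|N IH] k a kN ak.
  apply: zero => i; have /andP[a0 a1] := ak i; apply/le_anti; rewrite a0 andbT.
  have k0 : k i = 0%N by apply/eqP; rewrite -leqn0 -kN (bigD1 i) //= leq_addr.
  by move: a1; rewrite k0 mul0r.
have [i1 _ | none] := pickP (fun i : 'I_n => true); last first.
  by move: kN; rewrite big1 // => i; have := none i.
case: (@arg_maxP _ _ _ i1 xpredT a isT) => i0 _ amax0.
set M := a i0 in amax0.
have amax j : a j <= M by exact: amax0.
have [M0 | M0] := leP M 0.
  apply: zero => i; apply/le_anti; have /andP[-> _] := ak i.
  by rewrite andbT (le_trans _ M0) // amax.
have k0 : (0 < k i0)%N.
  rewrite lt0n; apply/negP => /eqP k0; have /andP[_] := ak i0.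
  by rewrite k0 mul0r -/M leNgt M0.
(* The largest entry drops by [dl], or to 0 if it is smaller than that. Its counter [k i0] drops by
   one, so the constraint a i <= k i dl persists while the total falls from N + 1 to N. *)
set m := Num.max 0 (M - dl); set e := M - m.
have m0 : 0 <= m by rewrite le_max lexx.
have mM : m <= M by rewrite ge_max ltW //= gerBl.
have e0 : 0 <= e by rewrite subr_ge0.
have ed : e <= dl by rewrite lerBlDl -lerBlDr le_max lexx orbT.
pose a' i := if i == i0 then m else a i.
pose k' i := if i == i0 then (k i0).-1 else k i.
have k'N : (\sum_i k' i)%N = N.
  apply/eqP; rewrite -eqSS -kN (bigD1 i0) //= [X in _ == X](bigD1 i0) //= /k' eqxx.
  rewrite -addSn prednK //; apply/eqP; congr addn; apply: eq_bigr => i /negbTE ->//.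
have a'k i : 0 <= a' i <= (k' i)%:R * dl.
  rewrite /a' /k'; case: eqP => [_|_]; last exact: ak.
  rewrite m0 /= ge_max mulr_ge0 //= lerBlDr.
  have /andP[_] := ak i0; rewrite -/M => h; apply: le_trans h _.
  by rewrite -[in leLHS](prednK k0) -natr1 mulrDl mul1r.
have [r' [r'0 Er' Hr']] := IH k' a' k'N a'k.
have a'M i : 0 <= a' i <= M.
  rewrite /a'; case: eqP => _; first by rewrite m0.
  by have /andP[-> _] := ak i; rewrite amax.
have [g Hg Eg] := det_rdiag_step i0 e uT b0 a'M r'0 Er'.
set g0 := \sum_j _ in Hg.
have bM j : 0 < 1 + M * b j by rewrite ltr_pwDl // mulr_ge0 // ltW.
have g00 : 0 <= g0.
  apply: sumr_ge0 => j _; rewrite mulr_ge0 ?normsq_ge0 // divr_ge0 // ltW //.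
have g0beta : g0 <= beta.
  rewrite -[beta]mul1r -(sum_normsq_row i0 uT) mulr_suml; apply: ler_sum => j _.
  rewrite ler_wpM2l ?normsq_ge0 //; apply: le_trans (bbeta j).
  rewrite ler_pdivrMr //; apply: ler_peMr; first exact: ltW.
  by rewrite lerDl; apply: mulr_ge0; exact: ltW.
have eg0 : 0 <= e * g0 by rewrite mulr_ge0.
have eg : e * g0 <= e * g by rewrite ler_wpM2l.
have pos : 0 < 1 + e * g by rewrite ltr_pwDl // (le_trans eg0).
exists (r' * (1 + e * g)); split; first by rewrite mulr_gt0.
  rewrite -Eg; congr (\det (_ + _ *m _)); congr diag_mx; apply/rowP => i.
  rewrite !mxE /a'; congr (_%:C); case: eqP => [->|_]; last by rewrite mulr0 addr0.
  by rewrite mulr1 /e -/M addrC subrK.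
rewrite lnM // (bigD1 i0) //= -/M.
have -> : \sum_(i | i != i0) diag_ln i (a i) = \sum_(i | i != i0) diag_ln i (a' i).
  by apply: eq_bigr => i /negbTE ii; rewrite /a' ii.
move: Hr'; rewrite (bigD1 i0) //= {1}/a' eqxx => Hr'.
(* The scalar bound of [ln_decrement], averaged with the weights |T_ij|^2, which sum to 1 over j. *)
have step : diag_ln i0 M <= diag_ln i0 m + e * g0 + e ^+ 2 * beta ^+ 2.
  rewrite -[e ^+ 2 * _]mul1r -(sum_normsq_row i0 uT) mulr_suml mulr_sumr.
  rewrite /diag_ln -!big_split /=; apply: ler_sum => j _.
  have eM : 0 <= e <= M by rewrite e0 /= lerBlDr lerDl.
  have := ln_decrementE (b0 j) eM; rewrite (_ : M - e = m); last by rewrite /e opprB addrC subrK.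
  move=> h; rewrite (mulrCA e) -!mulrDr ler_wpM2l ?normsq_ge0 //; apply: le_trans h _.
  rewrite lerD2l; apply: ler_wpM2l; first exact: sqr_ge0.
  by apply: lerXn2r; rewrite ?nnegrE // ltW // (lt_le_trans (b0 j)).
have incr := ln_incrementE eg0 eg.
(* One quadratic error comes from [ln_increment] and one from [ln_decrement]; together they are the
   2 dl^2 beta^2 charged to each step. *)
have sq : (e * g0) ^+ 2 <= dl ^+ 2 * beta ^+ 2.
  rewrite -exprMn; apply: lerXn2r; rewrite ?nnegrE //; last exact: ler_pM.
  by apply: mulr_ge0 => //; apply: le_trans g0beta.
have sq' : e ^+ 2 * beta ^+ 2 <= dl ^+ 2 * beta ^+ 2.
  by apply: ler_wpM2r; [exact: sqr_ge0 | apply: lerXn2r; rewrite ?nnegrE].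
rewrite -natr1.
move: Hr' step incr sq sq'.
set S := \sum_(i | _) _; set A := diag_ln i0 M; set A' := diag_ln i0 m.
set L := ln r'; set L' := ln (1 + e * g); set E := dl ^+ 2 * beta ^+ 2.
set P := e * g0; set Q := e ^+ 2 * beta ^+ 2; set P2 := P ^+ 2; set K := N%:R : R.
rewrite -mulrA -/E.
by move: S A A' L L' E P Q P2 K => *; lra.
Qed.

(** Mesh refinement in [logdet_grid]: the number of steps grows like 1 / dl while each costs order
    dl^2, so the total error vanishes. The determinant, and hence [r], is the same for every
    mesh. *)
Lemma logdet_ge (a : 'I_n -> R) : (forall i, 0 <= a i) ->
  exists r : R, [/\ 0 < r, \det (1%:M + rdiag a *m spec T b) = r%:C &
    \sum_i diag_ln i (a i) <= ln r].
Proof.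
move=> a0.
pose beta := \sum_j b j.
have bbeta j : b j <= beta.
  by rewrite /beta (bigD1 j) //= lerDl sumr_ge0 // => i _; exact: ltW.
have beta0 : 0 <= beta by apply: sumr_ge0 => j _; exact: ltW.
pose A := (Num.bound (\sum_j a j)).
have aA i : a i <= A%:R.
  apply: (@le_trans _ _ (\sum_j a j)); last first.
    by apply/ltW/archi_boundP/sumr_ge0 => j _.
  by rewrite (bigD1 i) //= lerDl sumr_ge0.
have grid (m : nat) := @logdet_grid beta (m.+1%:R^-1) (n * (A * m.+1))%N.
have ak m i : 0 <= a i <= (A * m.+1)%:R * (m.+1%:R^-1 : R).
  by rewrite a0 /= natrM mulfK ?aA // pnatr_eq0.
have kN m : (\sum_(i < n) (A * m.+1))%N = (n * (A * m.+1))%N.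
  by rewrite sum_nat_const card_ord.
have dl0 m : 0 <= (m.+1%:R^-1 : R) by rewrite invr_ge0.
have [r [r0 Er _]] := grid 0%N (dl0 _) bbeta _ _ (kN 0%N) (ak 0%N).
exists r; split=> //; apply/ler_addgt0Pr => e e0.
(* At mesh 1 / (m + 1) there are n A (m + 1) steps of cost 2 beta^2 / (m + 1)^2, in total c / (m +
   1). *)
pose c := 2 * n%:R * A%:R * beta ^+ 2.
have c0 : 0 <= c.
  exact: mulr_ge0 (mulr_ge0 (mulr_ge0 (ler0n _ 2) (ler0n _ _)) (ler0n _ _)) (sqr_ge0 _).
pose m := Num.bound (c / e).
have [r1 [_ Er1 H]] := grid m (dl0 _) bbeta _ _ (kN m) (ak m).
have -> : r = r1 by apply: (@complexI R); rewrite -Er -Er1.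
apply: le_trans H _; rewrite lerD2l.
have m0 : (m.+1%:R : R) != 0 by rewrite pnatr_eq0.
have -> : (n * (A * m.+1))%:R * (2 * m.+1%:R^-1 ^+ 2 * beta ^+ 2) = c / m.+1%:R.
  by rewrite !natrM /c; field.
rewrite ler_pdivrMr ?ltr0Sn // mulrC -ler_pdivrMr //.
apply/ltW/(lt_trans (archi_boundP _)).
  by apply: divr_ge0 => //; exact: ltW.
by rewrite /m ltr_nat.
Qed.

End LogDet.

Lemma wsumE (l : seq (R * R)) (f : R -> R) :
  wsum l f = \sum_(p <- l) p.1 * f p.2.
Proof. by elim: l => [|[c x] l IH] /=; rewrite ?big_nil ?big_cons // IH. Qed.

Lemma mem_In (T : eqType) (x : T) (s : seq T) : List.In x s -> x \in s.
Proof.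
by elim: s => //= y s IH [->|/IH xs]; rewrite in_cons ?eqxx ?xs ?orbT.
Qed.

Lemma ln_prod (I : finType) (f : I -> R) : (forall i, 0 < f i) ->
  ln (\prod_i f i) = \sum_i ln (f i).
Proof.
move=> f0.
suff [_ ->] : 0 < \prod_i f i /\ ln (\prod_i f i) = \sum_i ln (f i) by [].
apply: (big_ind2 (fun x y => 0 < x /\ ln x = y)) => [|x y x' y' [x0 <-] [x'0 <-]|i _].
- by rewrite ltr01 ln_1.
- by rewrite mulr_gt0 // lnM.
- by rewrite f0.
Qed.

Lemma RpowerD (x y z : R) : Rpower x (y + z) = Rpower x y * Rpower x z.
Proof. exact: Rpower_plus. Qed.

Lemma Rpower_gt0 (x y : R) : 0 < Rpower x y.
Proof. by apply/RltP; exact: exp_pos. Qed.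

Lemma RpowerMl (x y z : R) : 0 < x -> 0 < y -> Rpower (x * y) z = Rpower x z * Rpower y z.
Proof. by move=> /RltP x0 /RltP y0; apply/esym; exact: Rpower_mult_distr. Qed.

Lemma RpowerMr (x y z : R) : Rpower (Rpower x y) z = Rpower x (y * z).
Proof. exact: Rpower_mult. Qed.

Lemma Rpowerr1 (x : R) : 0 < x -> Rpower x 1 = x.
Proof. by move=> /RltP; exact: Rpower_1. Qed.

Section ArakiLiebThirring.
Variables (n : nat) (T H : 'M[CC]_n) (s b m : 'I_n -> R) (t : R).
Hypotheses (uT : uni T) (uH : uni H).
Hypotheses (s0 : forall i, 0 < s i) (b0 : forall i, 0 < b i).
Hypothesis sBs : rdiag s *m spec T b *m rdiag s = spec H m.

Let a (i : 'I_n) : R := s i * s i.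

(** With A = [rdiag a] and B = [spec T b], integrating f against this signed measure gives tr f
    (A^(1/2) B A^(1/2)) minus the sum of |T_ij|^2 f (a_i b_j). For f a power t the latter is tr (A^t
    B^t). *)
Let l : seq (R * R) := [seq (1, m k) | k <- index_enum 'I_n] ++
  [seq (- normsq (T p.1 p.2), a p.1 * b p.2) | p <- index_enum ('I_n * 'I_n)%type].

Let lE (f : R -> R) :
  wsum l f = \sum_k f (m k) - \sum_(i < n) \sum_(j < n) normsq (T i j) * f (a i * b j).
Proof.
rewrite wsumE big_cat !big_map /=; congr (_ + _).
  by apply: eq_bigr => k _; rewrite mul1r.
rewrite pair_bigA /= -sumrN; apply: eq_bigr => p _.
by rewrite mulNr.
Qed.

Let srdiag_unit : rdiag s \in unitmx.
Proof. by rewrite -spec1; apply: spec_unitmx => //; exact: uni1. Qed.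

Let ss : rdiag s *m rdiag s = rdiag a.
Proof. exact: rdiagM. Qed.

Let m0 k : 0 < m k.
Proof.
apply: (pdm_spec_gt0 k uH); rewrite -sBs -{1}ctr_rdiag.
exact/pdm_congr/pdm_spec.
Qed.

(** This is [logdet_ge] for u B. Conjugating by [rdiag s] turns 1 + u A B into 1 + u A^(1/2) B
    A^(1/2), whose determinant is the product of the 1 + u m_k. *)
Lemma sum_ln_conjugated_ge (u : R) : 0 < u ->
  \sum_i \sum_j normsq (T i j) * ln (1 + a i * b j * u) <= \sum_k ln (1 + m k * u).
Proof.
move=> u0.
have bu0 j : 0 < b j * u by exact: mulr_gt0.
have a0 i : 0 <= a i by apply: mulr_ge0; exact: ltW.
have [r [r0 Er]] := logdet_ge uT bu0 a0.
have -> : r = \prod_k (1 + m k * u).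
  apply: (@complexI R); rewrite -Er -(det_spec uH).
  have E : spec T (fun j => b j * u) = u%:C *: spec T b by exact: specZ.
  have E' : spec H (fun k => 1 + m k * u) = 1%:M + u%:C *: spec H m.
    by rewrite -(specD H (fun=> 1)) spec_const // specZ rmorph1.
  have F : (1%:M + rdiag a *m spec T (fun j => b j * u)) *m rdiag s =
           rdiag s *m spec H (fun k => 1 + m k * u).
    rewrite E E' -sBs -ss mulmxDl mulmxDr mul1mx mulmx1; congr (_ + _).
    by rewrite -!(scalemxAl, scalemxAr) !mulmxA.
  have := congr1 determinant F; rewrite !det_mulmx mulrC => /mulfI; apply.
  by have := srdiag_unit; rewrite unitmxE unitfE.
rewrite ln_prod => [Hle|k]; last by rewrite ltr_pwDl // mulr_ge0 // ltW.
apply: le_trans Hle; rewrite le_eqVlt; apply/orP; left; apply/eqP.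
by apply: eq_bigr => i _; apply: eq_bigr => j _; rewrite mulrA.
Qed.

(** The measure [l] meets the conditions of [wsum_Rpower_pos]: its logarithmic integrals are
    nonnegative, both parts have first moment tr (A B), and its second moment tr (A B A B) - tr (A^2
    B^2) is negative by non-commutation. *)
Lemma araki_lieb_thirring_strict : 0 < t < 1 ->
  rdiag a *m spec T b <> spec T b *m rdiag a ->
  \sum_i \sum_j normsq (T i j) * Rpower (a i * b j) t < \sum_k Rpower (m k) t.
Proof.
move=> /andP[/RltP t0 /RltP t1] nc.
rewrite -subr_gt0 -(lE (fun x => Rpower x t)); apply/RltP; apply: wsum_Rpower_pos => //.
- move=> p /mem_In; rewrite mem_cat => /orP[] /mapP[q _ ->] /=; apply/RltP => //.
  by rewrite /a !mulr_gt0.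
- move=> u /RltP u0; apply/RleP; rewrite (lE (fun x => ln (1 + x * u))) subr_ge0.
  exact: sum_ln_conjugated_ge.
- rewrite (lE id); apply/eqP; rewrite subr_eq0; apply/eqP; apply: (@complexI R).
  rewrite -trace_rdiag_spec -(trace_spec uH) -sBs -ss.
  by rewrite mxtrace_mulC !mulmxA.
- apply/RltP; rewrite (lE (fun x => pow x 2)) subr_lt0.
  have pow2 x : pow x 2 = x * x by rewrite RpowE expr2.
  have hA : ctr (rdiag a) = rdiag a by exact: ctr_rdiag.
  have hB : ctr (spec T b) = spec T b by exact: ctr_spec.
  have := trace_comm_lt hA hB nc.
  rewrite specM // rdiagM trace_rdiag_spec.
  have -> : \tr (rdiag a *m spec T b *m rdiag a *m spec T b) = (\sum_k m k * m k)%:C.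
    rewrite -(trace_spec uH) -specM // -sBs -ss.
    move: (rdiag s) (spec T b) => S B.
    by rewrite !mulmxA [RHS]mxtrace_mulC !mulmxA.
  move=> Hlt; rewrite (eq_bigr _ (fun k _ => pow2 (m k))).
  apply: lt_le_trans Hlt _; rewrite le_eqVlt; apply/orP; left; apply/eqP.
  apply: eq_bigr => i _; apply: eq_bigr => j _; rewrite pow2; congr (_ * _).
  by rewrite mulrACA.
Qed.

End ArakiLiebThirring.


(** * The measured sum lies below the sandwiched trace *)

Lemma measured_am_gmE (al p q b : R) : 0 < al < 1 -> 0 < p -> 0 < q -> 0 < b ->
  Rpower p al * Rpower q (1 - al) <= al * (p / b) + (1 - al) * (q * Rpower b (al / (1 - al))).
Proof.
move=> /andP[/RltP a0 /RltP a1] /RltP p0 /RltP q0 /RltP b0; rewrite -!RdivE.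
by apply/RleP; exact: measured_am_gm (conj a0 a1) p0 q0 b0.
Qed.

Lemma measured_lt_sandwiched (n : nat) (rho V G : 'M[CC]_n) (l s nu : 'I_n -> R) (al : R) :
  uni V -> uni G -> (forall i, 0 < l i) -> 0 < al < 1 / 2 -> pdm rho ->
  (forall i, s i = Rpower (l i) ((1 - al) / (2 * al))) ->
  spec V s *m rho *m spec V s = spec G nu ->
  rho *m spec V l <> spec V l *m rho ->
  exists W : 'M[CC]_n, uni W /\
  \sum_j Rpower (complex.Re ((ctr W *m rho *m W) j j)) al *
         Rpower (complex.Re ((ctr W *m spec V l *m W) j j)) (1 - al)
    < \sum_k Rpower (nu k) al.
Proof.
move=> uV uG l0 al0 rho0 hs srs nc.
have [a0 ah] := andP al0.
have a1 : al < 1 by move: a0 ah => ? ?; lra.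
have a10 : 0 < 1 - al by rewrite subr_gt0.
have s0 i : 0 < s i by rewrite hs; exact: Rpower_gt0.
set S := spec V s in srs *.
have hS : ctr S = S by exact: ctr_spec.
have uS : S \in unitmx by exact: spec_unitmx.
have nu0 k : 0 < nu k.
  by apply: (pdm_spec_gt0 k uG); rewrite -srs -{1}hS; exact: pdm_congr.
pose mu k := Rpower (nu k) (1 - al).
have mu0 k : 0 < mu k by exact: Rpower_gt0.
pose D := spec G (fun k => Rpower (nu k) (al - 1)).
(* K = S^-1 N^(1-al) S^-1 with N = [spec G nu], and its inverse is S N^(al-1) S. *)
have [K [pK SKS KD]] : exists K, [/\ pdm K, S *m K *m S = spec G mu &
    K *m (S *m D *m S) = 1%:M].
  pose S' := spec V (fun i => (s i)^-1).
  have SS' : S *m S' = 1%:M by exact: specV.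
  have S'S : S' *m S = 1%:M by exact: mulmx1C.
  have hS' : ctr S' = S' by exact: ctr_spec.
  have uS' : S' \in unitmx by have /mulmx1_unit[] := SS'.
  exists (S' *m spec G mu *m S'); split.
  - by have := pdm_congr uS' (pdm_spec uG mu0); rewrite hS'.
  - by rewrite !mulmxA SS' mul1mx -mulmxA S'S mulmx1.
  - rewrite -!mulmxA (mulmxA S' S) S'S mul1mx (mulmxA (spec G mu)) specM //.
    rewrite (eq_spec G (g := fun=> 1)) ?spec_const ?mul1mx // => k.
    rewrite /mu -RpowerD addrC subrKA subrr.
    by apply: Rpower_O; apply/RltP.
have [W [b [uW KE]]] := hermitian_spec pK.1.
have b0 j : 0 < b j by apply: (pdm_spec_gt0 j uW); rewrite -KE.
(* Passing to the eigenbasis V of sigma makes S diagonal, as the Araki-Lieb-Thirring inequality is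
   stated for a diagonal first factor. *)
have [T uT specT] : exists2 T, uni T & forall f, spec T f = ctr V *m spec W f *m V.
  exists (ctr V *m W); first exact: uniM (uni_ctr uV) uW.
  by move=> f; exact: spec_ctrM.
have [H uH specH] : exists2 H, uni H & forall f, spec H f = ctr V *m spec G f *m V.
  exists (ctr V *m G); first exact: uniM (uni_ctr uV) uG.
  by move=> f; exact: spec_ctrM.
have rdiagV f : rdiag f = ctr V *m spec V f *m V by rewrite spec_diag.
have VM (X Y : 'M[CC]_n) : ctr V *m X *m V *m (ctr V *m Y *m V) = ctr V *m (X *m Y) *m V.
  by rewrite !mulmxA -(mulmxA (ctr V *m X) V) uniC // mulmx1.
have VI (X Y : 'M[CC]_n) : ctr V *m X *m V = ctr V *m Y *m V -> X = Y.
  move=> /(congr1 (fun Z => V *m Z *m ctr V)).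
  by rewrite !mulmxA uniC // !mul1mx -!(mulmxA _ V) uniC // !mulmx1.
have sTs : rdiag s *m spec T b *m rdiag s = spec H mu.
  by rewrite rdiagV specT specH -KE !VM -/S SKS.
pose t := al / (1 - al).
have t01 : 0 < t < 1.
  rewrite divr_gt0 //= ltr_pdivrMr // mul1r.
  by move: a0 ah => ? ?; lra.
(* If K commuted with S^2, it would commute with S; then so would N^(1-al) = S K S, hence N = S rho
   S, hence rho after cancelling S, and rho would commute with sigma. *)
have ncT : rdiag (fun i => s i * s i) *m spec T b <> spec T b *m rdiag (fun i => s i * s i).
  rewrite rdiagV specT !VM -KE => /VI E; apply: nc.
  have KS : K *m S = S *m K.
    apply: (comm_spec uV _ (esym E)) => i j /eqP.
    by rewrite -!expr2 eqrXn2 ?ltW // => /eqP.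
  have GS : S *m spec G mu = spec G mu *m S.
    rewrite -SKS.
    have -> : S *m K *m S = S *m S *m K by rewrite -mulmxA KS mulmxA.
    by rewrite -!mulmxA KS.
  have NS : S *m spec G nu = spec G nu *m S.
    apply: comm_spec GS => // i j E'.
    have al1 : (1 - al) * (1 - al)^-1 = 1 by rewrite mulfV // gt_eqF.
    have := congr1 (fun x => Rpower x (1 - al)^-1) E'.
    by rewrite /mu !RpowerMr al1 !Rpowerr1.
  have rS : rho *m S = S *m rho.
    move: NS; rewrite -srs -!mulmxA => /(can_inj (mulKmx uS)).
    by rewrite !mulmxA => /(can_inj (mulmxK uS)).
  apply: comm_spec rS => // i j E'.
  have e1 : (1 - al) / (2 * al) * ((2 * al) / (1 - al)) = 1.
    by have p : al != 0 by [rewrite gt_eqF]; have q : 1 - al != 0 by [rewrite gt_eqF]; field; rewrite p q.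
  have := congr1 (fun x => Rpower x ((2 * al) / (1 - al))) E'.
  by rewrite !hs !RpowerMr e1 !Rpowerr1.
have alt := araki_lieb_thirring_strict uT uH s0 b0 sTs t01 ncT.
have alne : al != 0 by rewrite gt_eqF.
have al1ne : 1 - al != 0 by rewrite gt_eqF.
have Qmu : \sum_k Rpower (mu k) t = \sum_k Rpower (nu k) al.
  apply: eq_bigr => k _; rewrite /mu RpowerMr; congr (Rpower _ _).
  by rewrite /t; field.
(* The left side is tr (sigma K^t), and sigma = (S^2)^t because 2 t (1 - al) / (2 al) = 1. *)
have Wl : \sum_j Rpower (b j) t * complex.Re ((ctr W *m spec V l *m W) j j) =
    \sum_i \sum_j normsq (T i j) * Rpower (s i * s i * b j) t.
  rewrite trace_spec_diag.
  have -> : \tr (spec V l *m spec W (fun j => Rpower (b j) t)) =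
      \tr (rdiag l *m spec T (fun j => Rpower (b j) t)).
    by rewrite rdiagV specT VM [RHS]mxtrace_mulC mulmxA uniC // mul1mx.
  rewrite trace_rdiag_spec /=; apply: eq_bigr => i _; apply: eq_bigr => j _.
  congr (_ * _); rewrite RpowerMl ?mulr_gt0 // !hs -RpowerD RpowerMr; congr (_ * _).
  rewrite [X in Rpower _ X](_ : _ = 1) ?Rpowerr1 //.
  by rewrite /t; field; rewrite alne al1ne.
(* The left side is tr (rho K^-1) = tr (rho S N^(al-1) S) = tr (N N^(al-1)). *)
have Wr : \sum_j (b j)^-1 * complex.Re ((ctr W *m rho *m W) j j) = \sum_k Rpower (nu k) al.
  rewrite trace_spec_diag.
  have KV : K *m spec W (fun j => (b j)^-1) = 1%:M by rewrite KE specV.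
  have -> : spec W (fun j => (b j)^-1) = S *m D *m S.
    have uK : K \in unitmx by have /mulmx1_unit[] := KD.
    by apply: (can_inj (mulKmx uK)); rewrite KV KD.
  rewrite !mulmxA mxtrace_mulC !mulmxA srs /D specM // trace_spec //=.
  apply: eq_bigr => k _; rewrite -{1}(Rpowerr1 (nu0 k)) -RpowerD; congr (Rpower _ _).
  by rewrite addrC subrK.
exists W; split => //.
apply: (@le_lt_trans _ _ (\sum_j (al * (complex.Re ((ctr W *m rho *m W) j j) / b j) +
  (1 - al) * (complex.Re ((ctr W *m spec V l *m W) j j) * Rpower (b j) t)))).
  apply: ler_sum => j _; apply: measured_am_gmE => //; first by rewrite a0.
  - exact/pdm_diag/pdm_congr/rho0/uni_unit.
  - exact/pdm_diag/pdm_congr/pdm_spec/l0/uV/uni_unit.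
have -> : \sum_j (al * (complex.Re ((ctr W *m rho *m W) j j) / b j) +
    (1 - al) * (complex.Re ((ctr W *m spec V l *m W) j j) * Rpower (b j) t)) =
    al * (\sum_k Rpower (nu k) al) +
    (1 - al) * \sum_i \sum_j normsq (T i j) * Rpower (s i * s i * b j) t.
  rewrite -Wr -Wl !mulr_sumr -big_split; apply: eq_bigr => j _ /=.
  by congr (_ * _ + _ * _); exact: mulrC.
move: alt; rewrite Qmu -(ltr_pM2l a10).
by move: (\sum_k _) (\sum_i _) => X Y; lra.
Qed.

(** * Translation between the two encodings of complex matrices *)

Definition toC (z : Defs.C) : CC := re z +i* im z.
Definition ofC (z : CC) : Defs.C := mkC (complex.Re z) (complex.Im z).

Lemma toCK : cancel toC ofC. Proof. by case. Qed.
Lemma ofCK : cancel ofC toC. Proof. by case. Qed.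

Lemma toC_mul (x y : Defs.C) : toC (Cmul x y) = toC x * toC y.
Proof. by []. Qed.

Lemma toC_conj (x : Defs.C) : toC (Cconj x) = conjc (toC x).
Proof. by []. Qed.

Lemma toC_sum (n : nat) (f : nat -> Defs.C) : toC (Csum n f) = \sum_(i < n) toC (f i).
Proof.
elim: n => [|n IH]; first by rewrite big_ord0.
by rewrite big_ord_recr -IH.
Qed.

Lemma RsumE (n : nat) (f : nat -> R) : Rsum n f = \sum_(i < n) f i.
Proof.
elim: n => [|n IH]; first by rewrite big_ord0.
by rewrite big_ord_recr -IH.
Qed.

Section Transfer.
Variable d : nat.

Definition tomx (A : Mat) : 'M[CC]_d := \matrix_(i, j) toC (A i j).

Definition ofmx (M : 'M[CC]_d) : Mat := fun i j =>
  if insub i is Some i' then if insub j is Some j' then ofC (M i' j') else C0 else C0.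

Definition ext0 (f : 'I_d -> R) (i : nat) : R := if insub i is Some i' then f i' else 0.

Lemma ext0E (f : 'I_d -> R) (i : 'I_d) : ext0 f i = f i.
Proof. by rewrite /ext0 valK. Qed.

Lemma ofmxK : cancel ofmx tomx.
Proof. by move=> M; apply/matrixP => i j; rewrite !mxE /ofmx !valK ofCK. Qed.

Lemma mat_eqP (A B : Mat) : mat_eq d A B <-> tomx A = tomx B.
Proof.
split=> [AB|/matrixP AB i j /ssrnat.ltP id /ssrnat.ltP jd].
  by apply/matrixP => i j; rewrite !mxE AB //; exact/ssrnat.ltP.
by have := AB (Ordinal id) (Ordinal jd); rewrite !mxE => /(can_inj toCK).
Qed.

Lemma tomxM (A B : Mat) : tomx (mmul d A B) = tomx A *m tomx B.
Proof.
apply/matrixP => i j; rewrite !mxE toC_sum; apply: eq_bigr => k _.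
by rewrite !mxE toC_mul.
Qed.

Lemma tomx_adj (A : Mat) : tomx (adj A) = ctr (tomx A).
Proof. by apply/matrixP => i j; rewrite !mxE toC_conj. Qed.

Lemma tomx_idm : tomx idm = 1%:M.
Proof.
apply/matrixP => i j; rewrite !mxE /idm.
have -> : Nat.eqb i j = (i == j) by apply/PeanoNat.Nat.eqb_spec/eqP => [/val_inj|->].
by case: (i == j).
Qed.

Lemma tomx_diagm (l : nat -> R) : tomx (diagm l) = rdiag (fun i => l i).
Proof.
apply/matrixP => i j; rewrite !mxE /diagm.
have -> : Nat.eqb i j = (i == j) by apply/PeanoNat.Nat.eqb_spec/eqP => [/val_inj|->].
by case: eqP => [->|].
Qed.

Lemma toC_trace (A : Mat) : toC (trace d A) = \tr (tomx A).
Proof. by rewrite toC_sum; apply: eq_bigr => i _; rewrite mxE. Qed.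

Lemma unitaryP (U : Mat) : unitary d U <-> uni (tomx U).
Proof. by rewrite /unitary mat_eqP tomxM tomx_adj tomx_idm. Qed.

Lemma hermitianP (A : Mat) : hermitian d A <-> ctr (tomx A) = tomx A.
Proof. by rewrite /hermitian mat_eqP tomx_adj; split. Qed.

Lemma pdmP (A : Mat) : pd d A -> pdm (tomx A).
Proof.
case=> /hermitianP hA pA; split=> // x x0.
pose v (k : nat) : Defs.C := if insub k is Some k' then ofC (x k' 0) else C0.
have vE (k : 'I_d) : toC (v k) = x k 0 by rewrite /v valK ofCK.
have [k xk] : exists k, x k 0 != 0.
  apply/existsP; rewrite -negb_forall; apply: contra x0 => /forallP x0.
  by apply/eqP/colP => k; rewrite mxE; apply/eqP.
have /pA /RltP : exists i, (i < d)%coq_nat /\ v i <> C0.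
  exists k; split; first exact/ssrnat.ltP.
  by move=> vk; move: xk; rewrite -vE vk eqxx.
suff -> : form (tomx A) x x = toC (inner d v (mvec d A v)) by [].
rewrite /form -mulmxA mxE toC_sum; apply: eq_bigr => i _.
rewrite ctrE -vE toC_mul toC_conj mxE toC_sum; congr (_ * _).
by apply: eq_bigr => j _; rewrite mxE toC_mul vE.
Qed.

(** The spectral theorem provides a decomposition, so the [epsilon] choice meets its specification.
    [U] and [l] are read off the chosen value, so that [A] and [mfun d f A] share them. *)
Lemma mfun_spec (f : R -> R) (A : Mat) : hermitian d A ->
  exists (U : 'M[CC]_d) (l : 'I_d -> R), [/\ uni U, tomx A = spec U l &
    tomx (mfun d f A) = spec U (fun i => f (l i))].
Proof.
move=> /hermitianP /hermitian_spec [U [l [uU AE]]].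
have specE' (V : Mat) (g : nat -> R) :
    tomx (mmul d (mmul d V (diagm g)) (adj V)) = spec (tomx V) (fun i => g i).
  by rewrite !tomxM tomx_diagm tomx_adj spec_unfold.
rewrite /mfun; set P := (X in epsilon _ X).
have [|V [g [/unitaryP uV [/mat_eqP AV ->]]]] := epsilon_spec (inhabits (fun _ _ => C0)) P.
  pose V := ofmx U; pose g := ext0 l.
  exists (mmul d (mmul d V (diagm (fun i => f (g i)))) (adj V)), V, g.
  split; first by apply/unitaryP; rewrite ofmxK.
  split=> //; apply/mat_eqP; rewrite specE' ofmxK AE.
  by apply: eq_spec => i; rewrite /g ext0E.
exists (tomx V), (fun i => g i); split=> //; by rewrite -specE'.
Qed.

Definition vecmx (v : nat -> Vec) : 'M[CC]_d := \matrix_(k, i) toC (v i k).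

Lemma onbP (v : nat -> Vec) : onb d v <-> uni (vecmx v).
Proof.
have E (i j : 'I_d) : (ctr (vecmx v) *m vecmx v) i j = toC (inner d (v i) (v j)).
  rewrite mxE toC_sum; apply: eq_bigr => k _.
  by rewrite ctrE !mxE toC_mul toC_conj.
have eqbE (i j : 'I_d) : Nat.eqb i j = (i == j).
  by apply/PeanoNat.Nat.eqb_spec/eqP => [/val_inj|->].
split=> [o|/matrixP u i j /ssrnat.ltP id /ssrnat.ltP jd].
  apply/matrixP => i j; rewrite E (o i j (ssrnat.ltP (ltn_ord i)) (ssrnat.ltP (ltn_ord j))) mxE eqbE.
  by case: (i == j).
have := u (Ordinal id) (Ordinal jd); rewrite E mxE -eqbE /= => h.
by apply: (can_inj toCK); rewrite h; case: Nat.eqb.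
Qed.

(** The projector is a column times a row, so cyclicity of the trace leaves the expectation of A in
    the i-th basis vector. *)
Lemma meas_probE (A : Mat) (v : nat -> Vec) (i : 'I_d) :
  meas_prob d A v i = complex.Re ((ctr (vecmx v) *m tomx A *m vecmx v) i i).
Proof.
rewrite /meas_prob -[LHS]/(complex.Re (toC _)) toC_trace tomxM; congr complex.Re.
have -> : tomx (proj (v i)) = col i (vecmx v) *m row i (ctr (vecmx v)).
  apply/matrixP => k l; rewrite !mxE big_ord1 !mxE toC_mul toC_conj //.
rewrite -mulmxA mxtrace_mulC /mxtrace big_ord1.
rewrite -row_mul; move: (ctr (vecmx v) *m tomx A) (vecmx v) => M W.
by rewrite !mxE; apply: eq_bigr => k _; rewrite !mxE.
Qed.

Lemma meas_prob_gt0 (A : Mat) (v : nat -> Vec) (i : 'I_d) :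
  pd d A -> onb d v -> 0 < meas_prob d A v i.
Proof.
by move=> /pdmP pA /onbP uv; rewrite meas_probE; apply/pdm_diag/pdm_congr/pA/uni_unit.
Qed.

Lemma rpowE (x y : R) : 0 < x -> rpow x y = Rpower x y.
Proof. by move=> /RltP x0; rewrite /rpow; case: Rlt_dec. Qed.

Lemma meas_sumE (a : R) (rho sigma : Mat) (v : nat -> Vec) :
  pd d rho -> pd d sigma -> onb d v ->
  meas_sum d a rho sigma v = \sum_(i < d)
    Rpower (complex.Re ((ctr (vecmx v) *m tomx rho *m vecmx v) i i)) a *
    Rpower (complex.Re ((ctr (vecmx v) *m tomx sigma *m vecmx v) i i)) (1 - a).
Proof.
move=> pr ps o; rewrite /meas_sum RsumE; apply: eq_bigr => i _.
by rewrite -!meas_probE !rpowE ?meas_prob_gt0.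
Qed.

Lemma meas_sum_lt_sandwiched (a : R) (rho sigma : Mat) :
  pd d rho -> pd d sigma -> 0 < a < 1 / 2 ->
  ~ mat_eq d (mmul d rho sigma) (mmul d sigma rho) ->
  exists2 v, onb d v &
    let s := mfun d (fun x => rpow x ((1 - a) / (2 * a))%R) sigma in
    meas_sum d a rho sigma v <
      re (trace d (mfun d (fun x => rpow x a) (mmul d (mmul d s rho) s))).
Proof.
move=> pr ps a01 nc; set s := mfun _ _ _.
have [V [l [uV sE tsE]]] := mfun_spec (fun x => rpow x ((1 - a) / (2 * a))%R) (proj1 ps).
have l0 i : 0 < l i by apply: (pdm_spec_gt0 i uV); rewrite -sE; exact: pdmP.
set s' := fun i => rpow (l i) ((1 - a) / (2 * a))%R in tsE.
have s'0 i : 0 < s' i by rewrite /s' rpowE //; exact: Rpower_gt0.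
have NE : tomx (mmul d (mmul d s rho) s) = spec V s' *m tomx rho *m spec V s'.
  by rewrite !tomxM /s tsE.
have hS : ctr (spec V s') = spec V s' by exact: ctr_spec.
have pN : pdm (tomx (mmul d (mmul d s rho) s)).
  by have := pdm_congr (spec_unitmx uV s'0) (pdmP pr); rewrite hS -NE.
have [G [nu [uG GE tGE]]] := mfun_spec (fun x => rpow x a) (proj2 (hermitianP _) pN.1).
have nu0 k : 0 < nu k by apply: (pdm_spec_gt0 k uG); rewrite -GE.
have s'E i : s' i = Rpower (l i) ((1 - a) / (2 * a)) by rewrite /s' rpowE.
have nc' : tomx rho *m spec V l <> spec V l *m tomx rho.
  by rewrite -sE -!tomxM => /mat_eqP.
have [W [uW Wlt]] := measured_lt_sandwiched uV uG l0 a01 (pdmP pr) s'E (etrans (esym NE) GE) nc'.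
pose v (i k : nat) := ofmx W k i.
have vW : vecmx v = W by rewrite -[RHS]ofmxK; apply/matrixP => i j; rewrite !mxE.
have o : onb d v by apply/onbP; rewrite vW.
exists v; first exact: o.
rewrite /= (meas_sumE a pr ps o) vW sE.
set N := mmul _ _ _ in tGE *.
rewrite -[re _]/(complex.Re (toC (trace d (mfun d (fun x => rpow x a) N)))).
rewrite toC_trace tGE (trace_spec uG).
apply: lt_le_trans Wlt _; rewrite le_eqVlt; apply/orP; left; apply/eqP.
by apply: eq_bigr => k _; rewrite (rpowE _ (nu0 k)).
Qed.

End Transfer.

(** * The measured minimum is attained *)

Local Open Scope classical_set_scope.

Section ContinuityOverRealType.
Variables (K : realType) (T : topologicalType).

Lemma for_continuousD (f g : T -> K) (w : T) :
  {for w, continuous f} -> {for w, continuous g} -> {for w, continuous (fun x => f x + g x)}.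
Proof. by move=> cf cg; exact: cvgD cf cg. Qed.

Lemma for_continuousM (f g : T -> K) (w : T) :
  {for w, continuous f} -> {for w, continuous g} -> {for w, continuous (fun x => f x * g x)}.
Proof. by move=> cf cg; exact: cvgM cf cg. Qed.

Lemma for_continuousN (f : T -> K) (w : T) :
  {for w, continuous f} -> {for w, continuous (fun x => - f x)}.
Proof. by move=> cf; exact: cvgN cf. Qed.

Lemma closed_level (f : T -> K) (c : K) : continuous f -> closed [set w | f w = c].
Proof.
move=> cf; have -> : [set w | f w = c] = f @^-1` [set c] by [].
by apply: preimage_closed => [x _|]; [exact: cf | exact: closed_eq].
Qed.

End ContinuityOverRealType.

Section ComplexContinuity.
Variable T : topologicalType.

Definition ccont (f : T -> Defs.C) (w : T) :=
  {for w, continuous (fun x => re (f x))} /\ {for w, continuous (fun x => im (f x))}.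

Lemma ccont_cst (c : Defs.C) (w : T) : ccont (fun _ => c) w.
Proof. by split; exact: cvg_cst. Qed.

Lemma ccont_add (f g : T -> Defs.C) (w : T) :
  ccont f w -> ccont g w -> ccont (fun x => Cadd (f x) (g x)) w.
Proof. by move=> [f1 f2] [g1 g2]; split; apply: (@for_continuousD R T). Qed.

Lemma ccont_mul (f g : T -> Defs.C) (w : T) :
  ccont f w -> ccont g w -> ccont (fun x => Cmul (f x) (g x)) w.
Proof.
move=> [f1 f2] [g1 g2]; split.
  apply: (@for_continuousD R T); first exact: (@for_continuousM R T).
  by apply: (@for_continuousN R T); exact: (@for_continuousM R T).
by apply: (@for_continuousD R T); exact: (@for_continuousM R T).
Qed.

Lemma ccont_conj (f : T -> Defs.C) (w : T) : ccont f w -> ccont (fun x => Cconj (f x)) w.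
Proof. by move=> [f1 f2]; split=> //; exact: (@for_continuousN R T). Qed.

Lemma ccont_sum (n : nat) (f : T -> nat -> Defs.C) (w : T) :
  (forall i, ccont (fun x => f x i) w) -> ccont (fun x => Csum n (f x)) w.
Proof.
by move=> cf; elim: n => [|n IH]; [exact: ccont_cst | exact: ccont_add].
Qed.

Lemma Rpower_continuous (f : T -> R) (y : R) (w : T) : 0 < f w ->
  {for w, continuous f} -> {for w, continuous (fun x => Rpower (f x) y)}.
Proof.
move=> /RltP f0 cf; apply: (@continuous_comp _ _ _ f (fun z => Rpower z y)); first exact: cf.
apply/continuity_pt_cvg/derivable_continuous_pt.
by exists (y * Rpower (f w) (y - 1))%R; exact: derivable_pt_lim_power.
Qed.

End ComplexContinuity.

Section Minimum.
Variables (d : nat) (a : R) (rho sigma : Mat).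
Hypotheses (pr : pd d rho) (ps : pd d sigma).

(** A coordinate is given by the vector, the component, and real or imaginary part. The product
    topology on all families of reals makes evaluations continuous and boxes compact by
    Tychonoff. *)
Let I : eqType := (nat * nat * bool)%type.
Let T : topologicalType := prod_topology (fun _ : I => R).

Definition coords_vec (w : I -> R) : nat -> Vec :=
  fun i k => mkC (w (i, k, true)) (w (i, k, false)).

Let coords_ccont (i k : nat) (w : T) : ccont (fun x : T => coords_vec x i k) w.
Proof. by split; exact: (@proj_continuous I (fun _ => R) _ w). Qed.

Let inner_ccont (i j : nat) (w : T) :
  ccont (fun x : T => inner d (coords_vec x i) (coords_vec x j)) w.
Proof. by apply: ccont_sum => k; apply: ccont_mul; first apply: ccont_conj; exact: coords_ccont. Qed.

Let meas_prob_continuous (A : Mat) (i : nat) (w : T) :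
  {for w, continuous (fun x : T => meas_prob d A (coords_vec x) i)}.
Proof.
suff [] : ccont (fun x : T => trace d (mmul d (proj (coords_vec x i)) A)) w by [].
do 2! (apply: ccont_sum => ?); apply: ccont_mul; last exact: ccont_cst.
by apply: ccont_mul; last apply: ccont_conj; exact: coords_ccont.
Qed.

Let Rsum_continuous (n : nat) (f : T -> nat -> R) (w : T) :
  (forall i, (i < n)%N -> {for w, continuous (fun x => f x i)}) ->
  {for w, continuous (fun x => Rsum n (f x))}.
Proof.
elim: n => [|n IH] cf; first exact: cvg_cst.
apply: (@for_continuousD R T); last exact: cf.
by apply: IH => i id; apply: cf; exact: ltnW.
Qed.

(* On bases this is [meas_sum], which however is not continuous everywhere, because of [rpow]. *)
Let power_sum (w : I -> R) : R := Rsum d (fun i =>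
  Rpower (meas_prob d rho (coords_vec w) i) a *
  Rpower (meas_prob d sigma (coords_vec w) i) (1 - a)).

Let power_sumE (w : I -> R) : onb d (coords_vec w) ->
  meas_sum d a rho sigma (coords_vec w) = power_sum w.
Proof.
move=> o; rewrite /power_sum /meas_sum !RsumE; apply: eq_bigr => i _.
by rewrite !rpowE ?meas_prob_gt0.
Qed.

Let power_sum_continuous (w : T) : onb d (coords_vec w) ->
  {for w, continuous (power_sum : T -> R)}.
Proof.
move=> o; apply: Rsum_continuous => i id.
by apply: (@for_continuousM R T); apply: Rpower_continuous;
  rewrite ?(@meas_prob_gt0 d _ _ (Ordinal id)) //; exact: meas_prob_continuous.
Qed.

Let closed_onb : closed [set w : T | onb d (coords_vec w)].
Proof.
have -> : [set w : T | onb d (coords_vec w)] =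
  \bigcap_(p in [set p : nat * nat | (p.1 < d)%coq_nat /\ (p.2 < d)%coq_nat])
    ([set w : T | re (inner d (coords_vec w p.1) (coords_vec w p.2)) =
       re (if Nat.eqb p.1 p.2 then C1 else C0)] `&`
     [set w : T | im (inner d (coords_vec w p.1) (coords_vec w p.2)) =
       im (if Nat.eqb p.1 p.2 then C1 else C0)]).
  apply/seteqP; split=> w /= o.
    by move=> [i j] /= [id jd]; rewrite (o i j id jd).
  move=> i j id jd; have [] := o (i, j) (conj id jd).
  by move=> /=; case: (inner _ _ _) => x y; case: (if _ then _ else _) => x' y' /= -> ->.
apply: closed_bigI => -[i j] _ /=; apply: closedI; apply: (@closed_level R T) => w.
  by case: (inner_ccont i j w).
by case: (inner_ccont i j w).
Qed.

(** Orthonormality leaves coordinates with an index of at least [d] free, so the set of bases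
    becomes compact only after restriction to a box. *)
Let onb_box : set T := [set w : T | forall i, -1 <= w i <= 1] `&`
  [set w : T | onb d (coords_vec w)].

Let compact_onb : compact onb_box.
Proof.
apply: compact_closedI closed_onb.
apply: (@tychonoff I (fun _ => R) (fun _ => [set x | -1 <= x <= 1])) => i.
by have := @segment_compact R (-1) 1; rewrite set_itvE.
Qed.

(** Coordinates out of range are set to 0; the others lie in [-1, 1] because each basis vector has
    norm 1. *)
Let bounded_coords (v : nat -> Vec) : onb d v -> exists w : T,
  (forall i, -1 <= w i <= 1) /\ vecmx d (coords_vec w) = vecmx d v.
Proof.
move=> /onbP uv.
pose w (p : I) : R := if (p.1.1 < d)%N && (p.1.2 < d)%N then
  (if p.2 then re (v p.1.1 p.1.2) else im (v p.1.1 p.1.2)) else 0.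
exists w; split=> [[[i k] c]|].
  rewrite /w /=; case: ifP => [/andP[id kd]|_]; last by rewrite lerN10 ler01.
  have := sum_normsq_row (Ordinal id) (uni_ctr uv); rewrite (bigD1 (Ordinal kd)) //=.
  rewrite ctrE mxE /normsq /=.
  set S := \sum_(j < d | _) _ => E.
  have S0 : 0 <= S by apply: sumr_ge0 => j _; exact: normsq_ge0.
  case: c; rewrite -ler_norml -(@expr_le1 _ 2) // real_normK ?num_real // -E.
    by rewrite -addrA lerDl addr_ge0 // sqr_ge0.
  by rewrite sqrrN addrC addrA lerDr addr_ge0 // sqr_ge0.
apply/matrixP => k i; rewrite !mxE /coords_vec /w /= !ltn_ord /=.
by case: (v i k).
Qed.

Let vecmx_meas_sum (v v' : nat -> Vec) : onb d v -> vecmx d v' = vecmx d v ->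
  onb d v' /\ meas_sum d a rho sigma v' = meas_sum d a rho sigma v.
Proof.
move=> o E; have o' : onb d v' by apply/onbP; rewrite E; exact/onbP.
by split=> //; rewrite !meas_sumE // E.
Qed.

(** Extreme value theorem for [power_sum] on the compact box of bases; every basis has a
    representative there with the same measured sum. *)
Lemma meas_sum_min (v0 : nat -> Vec) : onb d v0 -> exists2 v, onb d v &
  forall v', onb d v' -> meas_sum d a rho sigma v <= meas_sum d a rho sigma v'.
Proof.
move=> o0.
have A0 : onb_box !=set0.
  have [w [w1 wE]] := bounded_coords o0.
  by exists w; split=> //; have [] := vecmx_meas_sum o0 wE.
have cA : {within onb_box, continuous (power_sum : T -> R)}.
  by apply: continuous_in_subspaceT => w /set_mem [_ o]; exact: power_sum_continuous.
have [w /set_mem [_ o] wmin] := @compact_EVT_min T R power_sum onb_box A0 compact_onb cA.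
exists (coords_vec w) => // v' o'; have [w' [w'1 E]] := bounded_coords o'.
have [ow' <-] := vecmx_meas_sum o' E.
by rewrite !power_sumE //; apply: wmin; apply/mem_set.
Qed.

End Minimum.

(** * Comparison of the measured and sandwiched entropies *)

Lemma meas_sum_gt0 (d : nat) (a : R) (rho sigma : Mat) (v : nat -> Vec) :
  (0 < d)%N -> pd d rho -> pd d sigma -> onb d v -> 0 < meas_sum d a rho sigma v.
Proof.
case: d => // d _ pr ps o; rewrite meas_sumE // big_ord_recl ltr_pwDl //.
  by apply: mulr_gt0; exact: Rpower_gt0.
by apply: sumr_ge0 => i _; apply/ltW/mulr_gt0; exact: Rpower_gt0.
Qed.

Lemma half_boundsE (a : R) : Rlt 0 a -> Rlt a (Rdiv 1 2) -> 0 < a < 1 / 2.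
Proof. by move=> /RltP a0 /RltP a1; apply/andP; split=> //; move: a1; rewrite RdivE. Qed.

Local Close Scope ring_scope.
Local Open Scope R_scope.

Theorem theorem7 (d : nat) (rho sigma : Mat) :
  density d rho -> pd d rho -> psd d sigma -> pd d sigma ->
  ~ mat_eq d (mmul d rho sigma) (mmul d sigma rho) ->
  forall a : R, 0 < a < 1 / 2 ->
    D_meas d a rho sigma > D_sand d a rho sigma /\
    exists v : nat -> Vec, onb d v /\
      D_cl d a (meas_prob d rho v) (meas_prob d sigma v) > D_sand d a rho sigma.
Proof.
move=> _ pr _ ps nc a [a0 a1].
(* In dimension 0 any two matrices agree, so they commute. *)
have d0 : (0 < d)%N.
  by case: d nc {pr ps} => // nc; case: nc => i j /PeanoNat.Nat.nlt_0_r.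
have a01 : a < 1 by Lra.lra.
have a02 := half_boundsE a0 a1.
have [v o vlt] := meas_sum_lt_sandwiched pr ps a02 nc.
have [v1 o1 v1min] := meas_sum_min a pr ps o.
have gt0 v' : onb d v' -> 0 < meas_sum d a rho sigma v'.
  by move=> o'; apply/RltP; exact: meas_sum_gt0.
(* The prefactor 1 / (a - 1) is negative, so a smaller positive sum gives a larger entropy. *)
split; last first.
  by exists v; split=> //; apply: scaled_ln_lt => //; split; [exact: gt0 | exact/RltP].
(* Attainment of the minimum makes the specification behind [meas_min] satisfiable, so the chosen
   value is the true minimum and lies below the sum at [v]. *)
have [|[v2 [o2 E2]] min2] := epsilon_spec (inhabits 0) (fun m =>
    (exists v, onb d v /\ m = meas_sum d a rho sigma v) /\
    forall v, onb d v -> m <= meas_sum d a rho sigma v).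
  exists (meas_sum d a rho sigma v1); split; first by exists v1.
  by move=> v' o'; apply/RleP; exact: v1min.
rewrite -/(meas_min d a rho sigma) in E2 min2.
apply: scaled_ln_lt => //; split; first by rewrite E2; exact: gt0.
by apply: Rle_lt_trans (min2 v o) _; exact/RltP.
Qed.
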